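(* Assume that $\mathrm{ZF}$ is consistent. Then $\mathrm{IZF}_{Ref}$ does not prove the statement ''every Cauchy sequence, with a modulus of convergence, of Cauchy sequences (of rationals) converges to a Cauchy sequence (of rationals) with a modulus of convergence''.
   Context: $\mathrm{IZF}_{Ref}$ is the theory in first-order intuitionistic logic with equality, in the language $\{\in\}$, with axioms: Extensionality, Empty Set, Pairing, Union, Infinity, Power Set, the Set Induction schema $(\forall x\,((\forall y\in x\;\phi(y))\to\phi(x)))\to\forall x\,\phi(x)$, the full Separation schema, and the Reflection schema: for every formula $\phi(x)$ (possibly with parameters) and every set $z$ there is a transitive set $Z$ containing $z$ and the parameters such that for all $x\in Z$, $\phi(x)$ holds iff $\phi(x)$ holds relativized to $Z$. (It is IZF with Collection replaced by Reflection.) The following notions are formalized in the language of set theory. A Cauchy sequence (of rationals) is a function $X:\mathbb N\to\mathbb Q$ such that for every positive rational $\epsilon$ there is $N\in\mathbb N$ with $|X(n)-X(m)|<\epsilon$ for all $m,n>N$. A modulus of convergence for $X$ is a function $f$ from the positive rationals to $\mathbb N$ such that for every positive rational $\epsilon$, $|X(n)-X(m)|<\epsilon$ for all $m,n>f(\epsilon)$. For Cauchy sequences $x,y$, the distance $d(x,y)$ is the sequence $n\mapsto|x(n)-y(n)|$; $x<y$ means that there are $m,N\in\mathbb N$, $m\ge 1$, with $x(k)+1/m<y(k)$ for all $k>N$; a rational is identified with the corresponding constant sequence. A sequence $\langle X_j\mid j\in\mathbb N\rangle$ of Cauchy sequences is Cauchy if for every positive rational $\epsilon$ there is $N$ with $d(X_j,X_k)<\epsilon$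 for all $j,k>N$; a modulus of convergence for it is a function $f$ from the positive rationals to $\mathbb N$ with $d(X_j,X_k)<\epsilon$ for all $j,k>f(\epsilon)$ and all positive rationals $\epsilon$ (the individual $X_j$ are not assumed to have moduli of convergence). The sequence converges to a Cauchy sequence $Y$ if for every positive rational $\epsilon$ there is $N$ with $d(X_j,Y)<\epsilon$ for all $j>N$. *)

(* Defs.v *)
From Stdlib Require Import List.
Import ListNotations.

(** De Bruijn syntax.  The language has no function symbols, so the terms are
    exactly the variables and substitution is renaming. *)
Inductive form : Type :=
| Bot : form
| Mem : nat -> nat -> form
| Eq  : nat -> nat -> form
| And : form -> form -> form
| Or  : form -> form -> form
| Imp : form -> form -> form
| All : form -> form
| Ex  : form -> form.

Definition up (f : nat -> nat) (i : nat) : nat :=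
  match i with 0 => 0 | S j => S (f j) end.

Fixpoint rename (f : nat -> nat) (phi : form) : form :=
  match phi with
  | Bot => Bot
  | Mem i j => Mem (f i) (f j)
  | Eq i j => Eq (f i) (f j)
  | And a b => And (rename f a) (rename f b)
  | Or a b => Or (rename f a) (rename f b)
  | Imp a b => Imp (rename f a) (rename f b)
  | All a => All (rename (up f) a)
  | Ex a => Ex (rename (up f) a)
  end.

Definition subst (x : nat) (phi : form) : form :=
  rename (fun i => match i with 0 => x | S j => j end) phi.

Fixpoint free_below (n : nat) (phi : form) : Prop :=
  match phi with
  | Bot => True
  | Mem i j | Eq i j => i < n /\ j < n
  | And a b | Or a b | Imp a b => free_below n a /\ free_below n b
  | All a | Ex a => free_below (S n) a
  end.

Fixpoint relativize (z : nat) (phi : form) : form :=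
  match phi with
  | Bot => Bot
  | Mem i j => Mem i j
  | Eq i j => Eq i j
  | And a b => And (relativize z a) (relativize z b)
  | Or a b => Or (relativize z a) (relativize z b)
  | Imp a b => Imp (relativize z a) (relativize z b)
  | All a => All (Imp (Mem 0 (S z)) (relativize (S z) a))
  | Ex a => Ex (And (Mem 0 (S z)) (relativize (S z) a))
  end.

Inductive logic : Type := intuitionistic | classical.

(** Natural deduction.  The theory [T] is meant to consist of sentences, which
    is why its members are not shifted in the quantifier rules. *)
Inductive derives (L : logic) (T : form -> Prop) : list form -> form -> Prop :=
| d_axiom G a : T a -> derives L T G a
| d_hyp G a : In a G -> derives L T G a
| d_botE G a : derives L T G Bot -> derives L T G a
| d_andI G a b : derives L T G a -> derives L T G b -> derives L T G (And a b)
| d_andE1 G a b : derives L T G (And a b) -> derives L T G a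
| d_andE2 G a b : derives L T G (And a b) -> derives L T G b
| d_orI1 G a b : derives L T G a -> derives L T G (Or a b)
| d_orI2 G a b : derives L T G b -> derives L T G (Or a b)
| d_orE G a b c : derives L T G (Or a b) ->
    derives L T (a :: G) c -> derives L T (b :: G) c -> derives L T G c
| d_impI G a b : derives L T (a :: G) b -> derives L T G (Imp a b)
| d_impE G a b : derives L T G (Imp a b) -> derives L T G a -> derives L T G b
| d_allI G a : derives L T (map (rename S) G) a -> derives L T G (All a)
| d_allE G a x : derives L T G (All a) -> derives L T G (subst x a)
| d_exI G a x : derives L T G (subst x a) -> derives L T G (Ex a)
| d_exE G a c : derives L T G (Ex a) ->
    derives L T (a :: map (rename S) G) (rename S c) -> derives L T G c
| d_eq_refl G x : derives L T G (Eq x x)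
| d_eq_subst G a x y : derives L T G (Eq x y) ->
    derives L T G (subst x a) -> derives L T G (subst y a)
| d_dne G a : L = classical ->
    derives L T G (Imp (Imp a Bot) Bot) -> derives L T G a.

Definition proves (L : logic) (T : form -> Prop) (phi : form) : Prop :=
  derives L T [] phi.

Definition consistent (L : logic) (T : form -> Prop) : Prop :=
  ~ proves L T Bot.

(** A [pform] is a formula to be placed under [d] quantifiers.  A variable is
    named by its level, i.e. the number of quantifiers above its binder; below
    [d] quantifiers, level [x] is the de Bruijn index [d - S x]. *)
Definition level := nat.
Definition pform := nat -> form.

Definition sentence (P : pform) : form := P 0.

Definition p_mem (x y : level) : pform := fun d => Mem (d - S x) (d - S y).
Definition p_eq (x y : level) : pform := fun d => Eq (d - S x) (d - S y).
Definition p_bot : pform := fun _ => Bot.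
Definition p_and (P Q : pform) : pform := fun d => And (P d) (Q d).
Definition p_or (P Q : pform) : pform := fun d => Or (P d) (Q d).
Definition p_imp (P Q : pform) : pform := fun d => Imp (P d) (Q d).
Definition p_iff (P Q : pform) : pform := p_and (p_imp P Q) (p_imp Q P).
Definition p_all (F : level -> pform) : pform := fun d => All (F d (S d)).
Definition p_ex (F : level -> pform) : pform := fun d => Ex (F d (S d)).

(** [inst phi [x0; x1; ...]] is [phi] with its free variables 0, 1, ... replaced
    by [x0], [x1], ..., and [inst_rel Z phi l] its relativization to [Z]. *)
Definition inst (phi : form) (l : list level) : pform :=
  fun d => rename (fun i => d - S (nth i l 0)) phi.
Definition inst_rel (Z : level) (phi : form) (l : list level) : pform :=
  fun d => relativize (d - S Z) (inst phi l d).

Fixpoint p_alls (n : nat) (F : list level -> pform) : pform :=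
  match n with
  | 0 => F []
  | S m => p_all (fun x => p_alls m (fun p => F (x :: p)))
  end.

Fixpoint p_all_mem (p : list level) (Z : level) : pform :=
  match p with
  | [] => p_imp p_bot p_bot
  | x :: q => p_and (p_mem x Z) (p_all_mem q Z)
  end.

(** Terms: variables, and descriptions "the z such that [D z]".  A formula
    P(t) with a description t stands for "there is z with [D z] and P(z)". *)
Inductive term : Type :=
| Var : level -> term
| The : (level -> pform) -> term.
Coercion Var : level >-> term.

Definition bind (t : term) (F : level -> pform) : pform :=
  match t with
  | Var x => F x
  | The D => p_ex (fun z => p_and (D z) (F z))
  end.

Definition t_mem (s t : term) : pform :=
  bind s (fun x => bind t (fun y => p_mem x y)).
Definition t_eq (s t : term) : pform :=
  bind s (fun x => bind t (fun y => p_eq x y)).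

Declare Scope set_scope.
Delimit Scope set_scope with set.
Bind Scope set_scope with pform term.
Local Open Scope set_scope.

Notation "s ∈ t" := (t_mem s t) (at level 70, no associativity) : set_scope.
Notation "s ≐ t" := (t_eq s t) (at level 70, no associativity) : set_scope.
Notation "⊥" := p_bot : set_scope.
Notation "P ∧ Q" := (p_and P Q) (at level 80, right associativity) : set_scope.
Notation "P ∨ Q" := (p_or P Q) (at level 85, right associativity) : set_scope.
Notation "P ⇒ Q" := (p_imp P Q) (at level 99, right associativity) : set_scope.
Notation "P ⇔ Q" := (p_iff P Q) (at level 95, no associativity) : set_scope.
Notation "¬ P" := (p_imp P p_bot) (at level 75, right associativity) : set_scope.
Notation "∀ x .. y , P" := (p_all (fun x => .. (p_all (fun y => P)) ..))
  (at level 200, x binder, y binder, right associativity) : set_scope.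
Notation "∃ x .. y , P" := (p_ex (fun x => .. (p_ex (fun y => P)) ..))
  (at level 200, x binder, y binder, right associativity) : set_scope.

Definition all_in (A : term) (F : level -> pform) : pform := ∀ x, x ∈ A ⇒ F x.
Definition ex_in (A : term) (F : level -> pform) : pform := ∃ x, x ∈ A ∧ F x.

Notation "∀[ A ] x .. y , P" := (all_in A (fun x => .. (all_in A (fun y => P)) ..))
  (at level 200, x binder, y binder, right associativity) : set_scope.
Notation "∃[ A ] x .. y , P" := (ex_in A (fun x => .. (ex_in A (fun y => P)) ..))
  (at level 200, x binder, y binder, right associativity) : set_scope.

Definition Sub (x y : level) : pform := ∀[x] z, z ∈ y.
Definition Transitive (x : level) : pform := ∀[x] y, Sub y x.

Definition Zero : term := The (fun z => ∀ y, ¬ y ∈ z).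
Definition Succ (t : term) : term :=
  The (fun z => bind t (fun x => ∀ y, y ∈ z ⇔ (y ∈ x ∨ y ≐ x))).
Definition Inductive_set (w : level) : pform := Zero ∈ w ∧ ∀[w] x, Succ x ∈ w.

Definition Extensionality : pform := ∀ x y, (∀ z, z ∈ x ⇔ z ∈ y) ⇒ x ≐ y.
Definition EmptySet : pform := ∃ x, ∀ y, ¬ y ∈ x.
Definition Pairing : pform := ∀ x y, ∃ z, ∀ u, u ∈ z ⇔ (u ≐ x ∨ u ≐ y).
Definition Union : pform := ∀ x, ∃ y, ∀ z, z ∈ y ⇔ (∃[x] u, z ∈ u).
Definition Infinity : pform := ∃ w, Inductive_set w.
Definition PowerSet : pform := ∀ x, ∃ y, ∀ z, z ∈ y ⇔ Sub z x.
Definition Foundation : pform :=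
  ∀ x, (∃ y, y ∈ x) ⇒ ∃[x] y, ¬ ∃[x] z, z ∈ y.

(** In the schemata [n] is the number of parameters [p] of [phi]; the variable 0
    of [phi] (in [Replacement], 0 and 1) is the argument, the others are [p]. *)
Definition Separation (n : nat) (phi : form) : pform :=
  p_alls n (fun p => ∀ a, ∃ b, ∀ x, x ∈ b ⇔ (x ∈ a ∧ inst phi (x :: p))).

Definition SetInduction (n : nat) (phi : form) : pform :=
  p_alls n (fun p =>
    (∀ x, (∀[x] y, inst phi (y :: p)) ⇒ inst phi (x :: p)) ⇒
    ∀ x, inst phi (x :: p)).

Definition Reflection (n : nat) (phi : form) : pform :=
  p_alls n (fun p => ∀ z, ∃ Z,
    Transitive Z ∧ z ∈ Z ∧ p_all_mem p Z ∧
    ∀[Z] x, inst phi (x :: p) ⇔ inst_rel Z phi (x :: p)).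

Definition Replacement (n : nat) (phi : form) : pform :=
  p_alls n (fun p =>
    (∀ x y z, inst phi (x :: y :: p) ∧ inst phi (x :: z :: p) ⇒ y ≐ z) ⇒
    ∀ a, ∃ b, ∀ y, y ∈ b ⇔ (∃[a] x, inst phi (x :: y :: p))).

Inductive common_axiom : form -> Prop :=
| ax_ext : common_axiom (sentence Extensionality)
| ax_empty : common_axiom (sentence EmptySet)
| ax_pairing : common_axiom (sentence Pairing)
| ax_union : common_axiom (sentence Union)
| ax_infinity : common_axiom (sentence Infinity)
| ax_power : common_axiom (sentence PowerSet)
| ax_separation n phi : free_below (S n) phi ->
    common_axiom (sentence (Separation n phi)).

Inductive ZF : form -> Prop :=
| ZF_common a : common_axiom a -> ZF a
| ZF_foundation : ZF (sentence Foundation)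
| ZF_replacement n phi : free_below (S (S n)) phi ->
    ZF (sentence (Replacement n phi)).

Inductive IZF_Ref : form -> Prop :=
| IZF_Ref_common a : common_axiom a -> IZF_Ref a
| IZF_Ref_induction n phi : free_below (S n) phi ->
    IZF_Ref (sentence (SetInduction n phi))
| IZF_Ref_reflection n phi : free_below (S n) phi ->
    IZF_Ref (sentence (Reflection n phi)).

Definition Omega : term :=
  The (fun z => Inductive_set z ∧ ∀ w, Inductive_set w ⇒ Sub z w).
Notation ω := Omega.

Definition UPair (s t : term) : term :=
  The (fun z => bind s (fun x => bind t (fun y => ∀ u, u ∈ z ⇔ (u ≐ x ∨ u ≐ y)))).
Definition OPair (s t : term) : term :=
  The (fun z => bind s (fun x => bind t (fun y =>
    z ≐ UPair (UPair x x) (UPair x y)))).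

Definition Function (f : level) (A B : term) : pform :=
  bind A (fun A => bind B (fun B =>
    (∀[f] p, ∃[A] x, ∃[B] y, p ≐ OPair x y) ∧
    (∀[A] x, ∃ y, OPair x y ∈ f ∧ ∀ z, OPair x z ∈ f ⇒ z ≐ y))).

Definition App (f x : term) : term := The (fun y => OPair x y ∈ f).

Definition One : term := Succ Zero.

Definition Add (s t : term) : term := The (fun z =>
  ∃ f, Function f ω ω ∧ App f Zero ≐ s ∧
       (∀[ω] n, App f (Succ n) ≐ Succ (App f n)) ∧ App f t ≐ z).
Definition Mul (s t : term) : term := The (fun z =>
  ∃ f, Function f ω ω ∧ App f Zero ≐ Zero ∧
       (∀[ω] n, App f (Succ n) ≐ Add (App f n) s) ∧ App f t ≐ z).

(** For elements of [ω], the order is [∈]. *)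
Notation "m < n" := (t_mem m n) : set_scope.

(** [Frac a b c], for a, b, c in [ω] with c > 0, is the rational (a - b) / c: the
    class of all triples (a', b', c') with (a - b) c' = (a' - b') c. *)
Definition Frac (a b c : term) : term := The (fun q =>
  bind a (fun a => bind b (fun b => bind c (fun c =>
    ∀ t, t ∈ q ⇔
      ∃[ω] a' b' c', Zero < c' ∧ t ≐ OPair (OPair a' b') c' ∧
        Add (Mul a c') (Mul b' c) ≐ Add (Mul a' c) (Mul b c'))))).

Definition Rationals : term := The (fun Q =>
  ∀ q, q ∈ Q ⇔ ∃[ω] a b c, Zero < c ∧ q ≐ Frac a b c).
Notation ℚ := Rationals.

Definition RLt (q r : term) : pform :=
  ∃[ω] a b c a' b' c',
    Zero < c ∧ Zero < c' ∧ q ≐ Frac a b c ∧ r ≐ Frac a' b' c' ∧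
    Add (Mul a c') (Mul b' c) < Add (Mul a' c) (Mul b c').

Definition RAdd (q r : term) : term := The (fun s =>
  ∃[ω] a b c a' b' c',
    Zero < c ∧ Zero < c' ∧ q ≐ Frac a b c ∧ r ≐ Frac a' b' c' ∧
    s ≐ Frac (Add (Mul a c') (Mul a' c)) (Add (Mul b c') (Mul b' c)) (Mul c c')).

Definition ROpp (q : term) : term := The (fun s =>
  ∃[ω] a b c, Zero < c ∧ q ≐ Frac a b c ∧ s ≐ Frac b a c).

Definition RSub (q r : term) : term := RAdd q (ROpp r).

Definition RZero : term := Frac Zero Zero One.

Definition RAbs (q : term) : term := The (fun s =>
  bind q (fun q => (¬ RLt q RZero ∧ s ≐ q) ∨ (RLt q RZero ∧ s ≐ ROpp q))).

Definition RInv (m : term) : term := Frac One Zero m.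

Definition PosRationals : term := The (fun P =>
  ∀ q, q ∈ P ⇔ (q ∈ ℚ ∧ RLt RZero q)).
Notation "ℚ⁺" := PosRationals : set_scope.

Definition Cauchy (X : level) : pform :=
  Function X ω ℚ ∧
  ∀[ℚ⁺] ε, ∃[ω] N, ∀[ω] m n, N < m ∧ N < n ⇒
    RLt (RAbs (RSub (App X n) (App X m))) ε.

Definition Modulus (f X : level) : pform :=
  Function f ℚ⁺ ω ∧
  ∀[ℚ⁺] ε, ∀[ω] m n, App f ε < m ∧ App f ε < n ⇒
    RLt (RAbs (RSub (App X n) (App X m))) ε.

Definition Dist (x y : term) : term := The (fun d =>
  Function d ω ℚ ∧
  ∀[ω] n, App d n ≐ RAbs (RSub (App x n) (App y n))).

Definition SeqLt (x y : term) : pform :=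
  ∃[ω] m N, Zero < m ∧
    ∀[ω] k, N < k ⇒ RLt (RAdd (App x k) (RInv m)) (App y k).

Definition Const (q : term) : term := The (fun c =>
  Function c ω ℚ ∧ ∀[ω] n, App c n ≐ q).

Definition CauchySequences : term := The (fun C => ∀ X, X ∈ C ⇔ Cauchy X).

Definition CauchySeqOfSeqs (S : level) : pform :=
  Function S ω CauchySequences ∧
  ∀[ℚ⁺] ε, ∃[ω] N, ∀[ω] j k, N < j ∧ N < k ⇒
    SeqLt (Dist (App S j) (App S k)) (Const ε).

Definition ModulusOfSeqs (f S : level) : pform :=
  Function f ℚ⁺ ω ∧
  ∀[ℚ⁺] ε, ∀[ω] j k, App f ε < j ∧ App f ε < k ⇒
    SeqLt (Dist (App S j) (App S k)) (Const ε).

Definition ConvergesTo (S Y : level) : pform :=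
  ∀[ℚ⁺] ε, ∃[ω] N, ∀[ω] j, N < j ⇒
    SeqLt (Dist (App S j) Y) (Const ε).

Definition cauchy_completeness : form := sentence (
  ∀ S, CauchySeqOfSeqs S ∧ (∃ f, ModulusOfSeqs f S) ⇒
    ∃ Y, Cauchy Y ∧ (∃ g, Modulus g Y) ∧ ConvergesTo S Y).

(* Main.v *)
From Stdlib Require Import List Arith Lia ZArith QArith Qabs Qround Lqa.
From Stdlib Require Import FunctionalExtensionality Classical ClassicalEpsilon.
Require Import Defs.
Import ListNotations.
Open Scope nat_scope.

(** The underivability is shown by a topological model.  Truth values are the open sets of
    a space, sets are well-founded trees whose branches carry truth values, and a formula
    with parameters in the model has an open set as its value.  Intuitionistic derivations
    preserve truth at every point ([soundness]), and the axioms are true at every point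
    ([IZF_Ref_valid]).  For Reflection, one witness for each formula, each list of
    parameters and each point suffices, because the truth of an existential statement is
    decided point by point.  So a small family can be closed under witnesses and under
    elements in countably many rounds ([hull_witnessing]), and a set with such a family of
    elements reflects all formulas at once ([witnessing_reflects]).

    The points of the space are the nondecreasing bounded sequences of rationals.  A
    neighbourhood of s consists of the sequences that agree with s on a given initial
    segment and whose limit is below a given bound, itself above the limit of s.  The
    generic sequence has, at the point s, the term s n at the index n.  It is a Cauchy
    sequence in the model: if s N + e exceeds the limit of s, then on the neighbourhood
    that fixes s up to N and has the bound s N + e all terms beyond N lie between s N and
    s N + e ([genericV_Cauchy]).

    Repeated for ever, the generic sequence gives a Cauchy sequence of Cauchy sequences
    with a constant modulus.  Suppose that it converged to a sequence Y with a modulus.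
    Then some neighbourhood O, of a constant sequence say, would carry for every e > 0 a
    locally constant rational function that is within 2e of the limit of s, for each s in
    O: the term of Y just beyond the index that the modulus gives for e
    ([completeness_approximates]).

    This is impossible ([incomplete]), because such a function cannot follow the limit as
    it rises to the bound b of O.  In fact ([climb]) a relatively clopen part of O that
    contains an eventually constant sequence contains eventually constant sequences whose
    final values are arbitrarily close to b.  For otherwise climb: keep an initial segment
    that already reaches the final value, then continue with a greater value, staying in
    the part and gaining each time at least half of what can be gained.  The limit of the
    climb is again a point of O.  If it belongs to the part, then so does a neighbourhood,
    and from every late stage a jump to a fixed value above the limit was possible; hence
    the gains did not tend to 0, against boundedness.  If it does not belong to the part,
    then neither do the late stages, which is absurd. *)

(** * The topological model of set theory *)

(** An interior operator is all that the interpretation uses of a topology. *)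
Class Space := {
  pt : Type;
  box : (pt -> Prop) -> pt -> Prop;
  box_incl : forall P t, box P t -> P t;
  box_mono : forall P Q t, (forall s, P s -> Q s) -> box P t -> box Q t;
  box_box : forall P t, box P t -> box (box P) t;
  box_and : forall P Q t, box P t -> box Q t -> box (fun s => P s /\ Q s) t;
  box_all : forall (P : pt -> Prop) t, (forall s, P s) -> box P t }.

Record Open {X : Space} := {
  holds :> pt -> Prop;
  holds_near : forall t, holds t -> box holds t }.
Arguments Open X : clear implicits.

Section Connectives.
Context {X : Space}.

Definition interior (P : pt -> Prop) : Open X :=
  {| holds := box P; holds_near := box_box P |}.

Lemma box_keep (P : Open X) (Q : pt -> Prop) t :
  P t -> box (fun s => P s -> Q s) t -> box Q t.
Proof.
  intros HP HQ. generalize (box_and _ _ _ (holds_near P t HP) HQ).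
  apply box_mono. tauto.
Qed.

Lemma box_keep_box (P Q : pt -> Prop) t :
  box P t -> box (fun s => box P s -> Q s) t -> box Q t.
Proof. apply (box_keep (interior P)). Qed.

Program Definition s_false : Open X := {| holds := fun _ => False |}.
Next Obligation. contradiction. Qed.

Program Definition s_and (P Q : Open X) : Open X := {| holds := fun t => P t /\ Q t |}.
Next Obligation. apply box_and; apply holds_near; assumption. Qed.

Program Definition s_or (P Q : Open X) : Open X := {| holds := fun t => P t \/ Q t |}.
Next Obligation.
  destruct H as [H | H]; apply holds_near in H; revert H; apply box_mono; tauto.
Qed.

Definition s_imp (P Q : Open X) : Open X := interior (fun t => P t -> Q t).

Definition s_all {A : Type} (F : A -> Open X) : Open X := interior (fun t => forall a, F a t).

Program Definition s_ex {A : Type} (F : A -> Open X) : Open X :=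
  {| holds := fun t => exists a, F a t |}.
Next Obligation.
  apply holds_near in H0. revert H0. apply box_mono. eauto.
Qed.

Program Definition s_prop (P : Prop) : Open X := {| holds := fun _ => P |}.
Next Obligation. apply box_all; auto. Qed.

End Connectives.

(** A set [sup A f e] has each [f a] as an element to the extent [e a]. *)
Inductive V {X : Space} : Type :=
| sup : forall A : Type, (A -> V) -> (A -> Open X) -> V.
Arguments V X : clear implicits.

Section Sets.
Context {X : Space}.

(** Extensionality unfolded recursively, as membership is defined from equality. *)
Fixpoint eqV (x y : V X) {struct x} : Open X :=
  match x, y with
  | sup A f e, sup B g d =>
      interior (fun t =>
        (forall a, e a t -> exists b, d b t /\ eqV (f a) (g b) t) /\
        (forall b, d b t -> exists a, e a t /\ eqV (f a) (g b) t))
  end.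

Definition memV (x y : V X) : Open X :=
  match y with sup B g d => s_ex (fun b => s_and (d b) (eqV x (g b))) end.

Lemma eqV_refl x t : eqV x x t.
Proof.
  revert t. induction x as [A f IH e]. intros t. simpl. apply box_all. intros s.
  split; intros a Ha; exists a; split; auto.
Qed.

Lemma eqV_sym x y t : eqV x y t -> eqV y x t.
Proof.
  revert y t. induction x as [A f IH e]; intros [B g d] t. simpl. apply box_mono.
  intros s [H1 H2]. split; intros a Ha.
  - destruct (H2 a Ha) as [b [Hb Hab]]. eauto.
  - destruct (H1 a Ha) as [b [Hb Hab]]. eauto.
Qed.

Lemma eqV_trans x y z t : eqV x y t -> eqV y z t -> eqV x z t.
Proof.
  revert y z t. induction x as [A f IH e]; intros [B g d] [C h k] t. simpl.
  intros H1 H2. generalize (box_and _ _ _ H1 H2). apply box_mono.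
  intros s [[P1 P2] [Q1 Q2]]. split; intros a Ha.
  - destruct (P1 a Ha) as [b [Hb Hab]]. destruct (Q1 b Hb) as [c [Hc Hbc]]. eauto.
  - destruct (Q2 a Ha) as [b [Hb Hab]]. destruct (P2 b Hb) as [c [Hc Hbc]]. eauto.
Qed.

Lemma memV_eq_l x x' y t : eqV x x' t -> memV x y t -> memV x' y t.
Proof.
  destruct y as [B g d]. simpl. intros E [b [Hb Hx]].
  exists b. split; [assumption|]. eauto using eqV_trans, eqV_sym.
Qed.

Lemma memV_eq_r x y y' t : eqV y y' t -> memV x y t -> memV x y' t.
Proof.
  destruct y as [B g d], y' as [C h k]. simpl. intros E [b [Hb Hx]].
  apply box_incl in E. destruct (proj1 E b Hb) as [c [Hc Hbc]].
  exists c. split; [assumption|]. eauto using eqV_trans.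
Qed.

Lemma memV_sup A f (e : A -> Open X) a t : e a t -> memV (f a) (sup A f e) t.
Proof. intros H. exists a. split; [assumption | apply eqV_refl]. Qed.

Lemma eqV_ext x y t : box (fun s => forall z, memV z x s <-> memV z y s) t -> eqV x y t.
Proof.
  destruct x as [A f e], y as [B g d]. intros H. simpl. revert H. apply box_mono.
  intros s H. split; intros a Ha.
  - apply H. apply memV_sup; assumption.
  - destruct (proj2 (H (g a)) (memV_sup B g d a s Ha)) as [b [Hb Hab]].
    exists b. split; [assumption|]. apply eqV_sym; assumption.
Qed.

Definition scons (x : V X) (r : nat -> V X) (i : nat) : V X :=
  match i with 0 => x | S j => r j end.

Fixpoint ev (phi : form) (r : nat -> V X) : Open X :=
  match phi with
  | Bot => s_false
  | Mem i j => memV (r i) (r j)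
  | Eq i j => eqV (r i) (r j)
  | And a b => s_and (ev a r) (ev b r)
  | Or a b => s_or (ev a r) (ev b r)
  | Imp a b => s_imp (ev a r) (ev b r)
  | All a => s_all (fun x => ev a (scons x r))
  | Ex a => s_ex (fun x => ev a (scons x r))
  end.

Lemma ev_rename f phi r : ev (rename f phi) r = ev phi (fun i => r (f i)).
Proof.
  assert (Hup : forall f (x : V X) r,
    (fun i => scons x r (up f i)) = scons x (fun i => r (f i))).
  { intros. apply functional_extensionality. intros [|i]; reflexivity. }
  revert f r. induction phi; intros f r; simpl; try reflexivity;
    try (rewrite IHphi1, IHphi2; reflexivity);
    f_equal; apply functional_extensionality; intros x; rewrite IHphi, Hup; reflexivity.
Qed.

Lemma ev_subst x phi r : ev (subst x phi) r = ev phi (scons (r x) r).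
Proof.
  unfold subst. rewrite ev_rename. f_equal.
  apply functional_extensionality. intros [|i]; reflexivity.
Qed.

Lemma ev_shift phi x r : ev (rename S phi) (scons x r) = ev phi r.
Proof. rewrite ev_rename. reflexivity. Qed.

(** The variables are infinitely many, and an infinite intersection of open sets need not
    be open; so the equations are assumed to hold together near the point. *)
Lemma ev_congr phi r r' t :
  box (fun s => forall i, eqV (r i) (r' i) s) t -> ev phi r t -> ev phi r' t.
Proof.
  assert (Hup : forall (r r' : nat -> V X) x t, box (fun s => forall i, eqV (r i) (r' i) s) t ->
    box (fun s => forall i, eqV (scons x r i) (scons x r' i) s) t).
  { intros r0 r1 x t0. apply box_mono. intros s H [|i]; [apply eqV_refl | apply H]. }
  assert (Hsym : forall (r r' : nat -> V X) t, box (fun s => forall i, eqV (r i) (r' i) s) t ->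
    box (fun s => forall i, eqV (r' i) (r i) s) t).
  { intros r0 r1 t0. apply box_mono. intros s H i. apply eqV_sym, H. }
  revert r r' t. induction phi; intros r r' t E; simpl.
  - tauto.
  - apply box_incl in E. intros H. eapply memV_eq_l; [apply E|]. eapply memV_eq_r; [apply E|].
    assumption.
  - apply box_incl in E. intros H. eapply eqV_trans; [apply eqV_sym, E|].
    eapply eqV_trans; [eassumption | apply E].
  - intros [H1 H2]. eauto.
  - intros [H | H]; eauto.
  - intros H. generalize (box_and _ _ _ (box_box _ _ E) H). apply box_mono.
    intros s [E' H'] Ha. eauto.
  - intros H. generalize (box_and _ _ _ (box_box _ _ E) H). apply box_mono.
    intros s [E' H'] x. eauto.
  - intros [x H]. exists x. eauto.
Qed.

Lemma ev_congr1 phi x y r t :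
  eqV x y t -> ev phi (scons x r) t -> ev phi (scons y r) t.
Proof.
  intros E. apply ev_congr. apply (box_keep (eqV x y)); [assumption|]. apply box_all.
  intros s H [|i]; [assumption | apply eqV_refl].
Qed.

(** The rules for implication and the universal quantifier need their context on a whole
    neighbourhood; there it is true because it is finite. *)
Lemma soundness T G phi :
  (forall a, T a -> forall r t, ev a r t) -> derives intuitionistic T G phi ->
  forall r t, (forall a, In a G -> ev a r t) -> ev phi r t.
Proof.
  intros HT D.
  assert (Hbox : forall (G : list form) r t, (forall a, In a G -> ev a r t) ->
    box (fun s => forall a, In a G -> ev a r s) t).
  { clear. intros G r t. induction G as [|b G IH]; intros H.
    - apply box_all. intros s a [].
    - apply (box_keep (ev b r)). { apply H. left; reflexivity. }
      apply (box_keep_box (fun s => forall a, In a G -> ev a r s)).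
      { apply IH. intros; apply H; right; assumption. }
      apply box_all. intros s H1 H2 a [<- | Ha]; [|apply box_incl in H1]; auto. }
  induction D; intros r t HG; simpl.
  - apply HT; assumption.
  - apply HG; assumption.
  - destruct (IHD r t HG).
  - split; eauto.
  - apply (IHD r t HG).
  - apply (IHD r t HG).
  - left; eauto.
  - right; eauto.
  - destruct (IHD1 r t HG) as [H | H]; [apply IHD2 | apply IHD3];
      intros x [<- | Hx]; auto.
  - generalize (Hbox _ _ _ HG). apply box_mono. intros s Hs Ha. apply IHD.
    intros x [<- | Hx]; auto.
  - apply (box_incl _ _ (IHD1 r t HG)). eauto.
  - generalize (Hbox _ _ _ HG). apply box_mono. intros s Hs x. apply IHD.
    intros b Hb. apply in_map_iff in Hb. destruct Hb as [c [<- Hc]].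
    rewrite ev_shift. auto.
  - rewrite ev_subst. apply (box_incl _ _ (IHD r t HG)).
  - exists (r x). rewrite <- ev_subst. eauto.
  - destruct (IHD1 r t HG) as [x Hx].
    rewrite <- (ev_shift c x r). apply IHD2.
    intros b [<- | Hb]; [assumption|]. apply in_map_iff in Hb. destruct Hb as [c' [<- Hc]].
    rewrite ev_shift. auto.
  - apply eqV_refl.
  - rewrite ev_subst. eapply ev_congr1; [apply (IHD1 r t HG)|].
    rewrite <- ev_subst. eauto.
  - discriminate.
Qed.

End Sets.

(** * Interpretation of the defined notions *)

(** A description is kept as a property, because it may fail to denote, or may denote
    only on a part of the space. *)
Inductive sterm {X : Space} : Type :=
| SVar : V X -> sterm
| SThe : (V X -> Open X) -> sterm.
Arguments sterm X : clear implicits.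

Definition s_bind {X : Space} (t : sterm X) (F : V X -> Open X) : Open X :=
  match t with
  | SVar x => F x
  | SThe D => s_ex (fun z => s_and (D z) (F z))
  end.

Definition s_iff {X : Space} (P Q : Open X) : Open X := s_and (s_imp P Q) (s_imp Q P).

(** The formal notions, read with elements of the model for levels and with open sets for
    formulas.  Here the model can be studied without the bookkeeping of levels; the
    translation below shows that these are the values of the formal notions. *)
Module Sem.

Coercion SVar : V >-> sterm.
Declare Scope sem_scope.
Delimit Scope sem_scope with sem.
Bind Scope sem_scope with Open sterm.
Local Open Scope sem_scope.

Definition t_mem {X : Space} (s t : sterm X) : Open X :=
  s_bind s (fun x => s_bind t (fun y => memV x y)).
Definition t_eq {X : Space} (s t : sterm X) : Open X :=
  s_bind s (fun x => s_bind t (fun y => eqV x y)).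

Notation "s ∈ t" := (t_mem s t) (at level 70, no associativity) : sem_scope.
Notation "s ≐ t" := (t_eq s t) (at level 70, no associativity) : sem_scope.
Notation "⊥" := s_false : sem_scope.
Notation "P ∧ Q" := (s_and P Q) (at level 80, right associativity) : sem_scope.
Notation "P ∨ Q" := (s_or P Q) (at level 85, right associativity) : sem_scope.
Notation "P ⇒ Q" := (s_imp P Q) (at level 99, right associativity) : sem_scope.
Notation "P ⇔ Q" := (s_iff P Q) (at level 95, no associativity) : sem_scope.
Notation "¬ P" := (s_imp P s_false) (at level 75, right associativity) : sem_scope.
Notation "∀ x .. y , P" := (@s_all _ (V _) (fun x => .. (@s_all _ (V _) (fun y => P)) ..))
  (at level 200, x binder, y binder, right associativity) : sem_scope.
Notation "∃ x .. y , P" := (@s_ex _ (V _) (fun x => .. (@s_ex _ (V _) (fun y => P)) ..))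
  (at level 200, x binder, y binder, right associativity) : sem_scope.
Notation "m < n" := (t_mem m n) : sem_scope.

Section Definitions.
Context {X : Space}.

Definition all_in (A : sterm X) (F : V X -> Open X) : Open X := ∀ x, x ∈ A ⇒ F x.
Definition ex_in (A : sterm X) (F : V X -> Open X) : Open X := ∃ x, x ∈ A ∧ F x.

Notation "∀[ A ] x .. y , P" := (all_in A (fun x => .. (all_in A (fun y => P)) ..))
  (at level 200, x binder, y binder, right associativity) : sem_scope.
Notation "∃[ A ] x .. y , P" := (ex_in A (fun x => .. (ex_in A (fun y => P)) ..))
  (at level 200, x binder, y binder, right associativity) : sem_scope.

Definition Sub (x y : V X) : Open X := ∀[x] z, z ∈ y.
Definition Transitive (x : V X) : Open X := ∀[x] y, Sub y x.

Definition Zero : sterm X := SThe (fun z => ∀ y, ¬ y ∈ z).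
Definition Succ (t : sterm X) : sterm X :=
  SThe (fun z => s_bind t (fun x => ∀ y, y ∈ z ⇔ (y ∈ x ∨ y ≐ x))).
Definition Inductive_set (w : V X) : Open X := Zero ∈ w ∧ ∀[w] x, Succ x ∈ w.

Definition Omega : sterm X :=
  SThe (fun z => Inductive_set z ∧ ∀ w, Inductive_set w ⇒ Sub z w).

Definition UPair (s t : sterm X) : sterm X :=
  SThe (fun z => s_bind s (fun x => s_bind t (fun y => ∀ u, u ∈ z ⇔ (u ≐ x ∨ u ≐ y)))).
Definition OPair (s t : sterm X) : sterm X :=
  SThe (fun z => s_bind s (fun x => s_bind t (fun y =>
    z ≐ UPair (UPair x x) (UPair x y)))).

Definition Function (f : V X) (A B : sterm X) : Open X :=
  s_bind A (fun A => s_bind B (fun B =>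
    (∀[f] p, ∃[A] x, ∃[B] y, p ≐ OPair x y) ∧
    (∀[A] x, ∃ y, OPair x y ∈ f ∧ ∀ z, OPair x z ∈ f ⇒ z ≐ y))).

Definition App (f x : sterm X) : sterm X := SThe (fun y => OPair x y ∈ f).

Definition One : sterm X := Succ Zero.

Definition Add (s t : sterm X) : sterm X := SThe (fun z =>
  ∃ f, Function f Omega Omega ∧ App f Zero ≐ s ∧
       (∀[Omega] n, App f (Succ n) ≐ Succ (App f n)) ∧ App f t ≐ z).
Definition Mul (s t : sterm X) : sterm X := SThe (fun z =>
  ∃ f, Function f Omega Omega ∧ App f Zero ≐ Zero ∧
       (∀[Omega] n, App f (Succ n) ≐ Add (App f n) s) ∧ App f t ≐ z).

Definition Frac (a b c : sterm X) : sterm X := SThe (fun q =>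
  s_bind a (fun a => s_bind b (fun b => s_bind c (fun c =>
    ∀ t, t ∈ q ⇔
      ∃[Omega] a' b' c', Zero < c' ∧ t ≐ OPair (OPair a' b') c' ∧
        Add (Mul a c') (Mul b' c) ≐ Add (Mul a' c) (Mul b c'))))).

Definition Rationals : sterm X := SThe (fun Q =>
  ∀ q, q ∈ Q ⇔ ∃[Omega] a b c, Zero < c ∧ q ≐ Frac a b c).

Definition RLt (q r : sterm X) : Open X :=
  ∃[Omega] a b c a' b' c',
    Zero < c ∧ Zero < c' ∧ q ≐ Frac a b c ∧ r ≐ Frac a' b' c' ∧
    Add (Mul a c') (Mul b' c) < Add (Mul a' c) (Mul b c').

Definition RAdd (q r : sterm X) : sterm X := SThe (fun s =>
  ∃[Omega] a b c a' b' c',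
    Zero < c ∧ Zero < c' ∧ q ≐ Frac a b c ∧ r ≐ Frac a' b' c' ∧
    s ≐ Frac (Add (Mul a c') (Mul a' c)) (Add (Mul b c') (Mul b' c)) (Mul c c')).

Definition ROpp (q : sterm X) : sterm X := SThe (fun s =>
  ∃[Omega] a b c, Zero < c ∧ q ≐ Frac a b c ∧ s ≐ Frac b a c).

Definition RSub (q r : sterm X) : sterm X := RAdd q (ROpp r).

Definition RZero : sterm X := Frac Zero Zero One.

Definition RAbs (q : sterm X) : sterm X := SThe (fun s =>
  s_bind q (fun q => (¬ RLt q RZero ∧ s ≐ q) ∨ (RLt q RZero ∧ s ≐ ROpp q))).

Definition RInv (m : sterm X) : sterm X := Frac One Zero m.

Definition PosRationals : sterm X := SThe (fun P =>
  ∀ q, q ∈ P ⇔ (q ∈ Rationals ∧ RLt RZero q)).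

Definition Cauchy (Y : V X) : Open X :=
  Function Y Omega Rationals ∧
  ∀[PosRationals] ε, ∃[Omega] N, ∀[Omega] m n, N < m ∧ N < n ⇒
    RLt (RAbs (RSub (App Y n) (App Y m))) ε.

Definition Modulus (f Y : V X) : Open X :=
  Function f PosRationals Omega ∧
  ∀[PosRationals] ε, ∀[Omega] m n, App f ε < m ∧ App f ε < n ⇒
    RLt (RAbs (RSub (App Y n) (App Y m))) ε.

Definition Dist (x y : sterm X) : sterm X := SThe (fun d =>
  Function d Omega Rationals ∧
  ∀[Omega] n, App d n ≐ RAbs (RSub (App x n) (App y n))).

Definition SeqLt (x y : sterm X) : Open X :=
  ∃[Omega] m N, Zero < m ∧
    ∀[Omega] k, N < k ⇒ RLt (RAdd (App x k) (RInv m)) (App y k).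

Definition Const (q : sterm X) : sterm X := SThe (fun c =>
  Function c Omega Rationals ∧ ∀[Omega] n, App c n ≐ q).

Definition CauchySequences : sterm X := SThe (fun C => ∀ Y, Y ∈ C ⇔ Cauchy Y).

Definition CauchySeqOfSeqs (S : V X) : Open X :=
  Function S Omega CauchySequences ∧
  ∀[PosRationals] ε, ∃[Omega] N, ∀[Omega] j k, N < j ∧ N < k ⇒
    SeqLt (Dist (App S j) (App S k)) (Const ε).

Definition ModulusOfSeqs (f S : V X) : Open X :=
  Function f PosRationals Omega ∧
  ∀[PosRationals] ε, ∀[Omega] j k, App f ε < j ∧ App f ε < k ⇒
    SeqLt (Dist (App S j) (App S k)) (Const ε).

Definition ConvergesTo (S Y : V X) : Open X :=
  ∀[PosRationals] ε, ∃[Omega] N, ∀[Omega] j, N < j ⇒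
    SeqLt (Dist (App S j) Y) (Const ε).

Definition cauchy_completeness : Open X :=
  ∀ S, CauchySeqOfSeqs S ∧ (∃ f, ModulusOfSeqs f S) ⇒
    ∃ Y, Cauchy Y ∧ (∃ g, Modulus g Y) ∧ ConvergesTo S Y.

End Definitions.
End Sem.

Definition emptyV {X : Space} : V X := sup False (False_rect _) (fun _ => s_false).

Section Translation.
Context {X : Space}.
Context (r : nat -> V X).

Fixpoint env (w : list (V X)) : nat -> V X :=
  match w with [] => r | v :: w => scons v (env w) end.

Definition denotes_level (w : list (V X)) (x : level) (v : V X) : Prop :=
  x < length w /\ env w (length w - S x) = v.

Definition extends (w w' : list (V X)) : Prop := exists l, w' = l ++ w.

(** The valuation [env w] lists the values of the quantified levels, the innermost first;
    under [length w] quantifiers it matches the de Bruijn indices. *)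
Definition tr_form (w : list (V X)) (P : pform) (phi : Open X) : Prop :=
  ev (P (length w)) (env w) = phi.

(** Bodies of binders are compared in all longer environments, because a description is
    also evaluated under quantifiers that were introduced after it was formed. *)
Definition tr_fun (w : list (V X)) (F : level -> pform) (G : V X -> Open X) : Prop :=
  forall w', extends w w' -> forall x v, denotes_level w' x v -> tr_form w' (F x) (G v).

Definition tr_term (w : list (V X)) (t : term) (s : sterm X) : Prop :=
  match t, s with
  | Var x, SVar v => denotes_level w x v
  | The D, SThe G => tr_fun w D G
  | _, _ => False
  end.

Lemma extends_refl w : extends w w.
Proof. exists []. reflexivity. Qed.

Lemma extends_trans w w' w'' : extends w w' -> extends w' w'' -> extends w w''.
Proof. intros [l ->] [l' ->]. exists (l' ++ l). apply app_assoc. Qed.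

Lemma denotes_level_mono w w' x v : extends w w' -> denotes_level w x v -> denotes_level w' x v.
Proof.
  intros [l ->] [H1 H2]. unfold denotes_level. rewrite length_app. split; [lia|].
  rewrite <- H2. replace (length l + length w - S x) with (length l + (length w - S x)) by lia.
  clear. induction l; [reflexivity | assumption].
Qed.

Lemma denotes_level_new w v : denotes_level (v :: w) (length w) v.
Proof.
  split; simpl; [lia|]. rewrite Nat.sub_diag. reflexivity.
Qed.

Lemma tr_term_mono w w' t s : extends w w' -> tr_term w t s -> tr_term w' t s.
Proof.
  destruct t, s; simpl; try tauto.
  - apply denotes_level_mono.
  - intros E H w'' E'. apply H. eauto using extends_trans.
Qed.

Lemma tr_fun_mono w w' F G : extends w w' -> tr_fun w F G -> tr_fun w' F G.
Proof. intros E H w'' E'. apply H. eauto using extends_trans. Qed.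

Lemma tr_fun_here w F G x v : tr_fun w F G -> denotes_level w x v -> tr_form w (F x) (G v).
Proof. intros H. apply H. apply extends_refl. Qed.

Lemma tr_bot w : tr_form w p_bot s_false.
Proof. reflexivity. Qed.
Lemma tr_and w P Q p q : tr_form w P p -> tr_form w Q q -> tr_form w (p_and P Q) (s_and p q).
Proof. intros <- <-. reflexivity. Qed.
Lemma tr_or w P Q p q : tr_form w P p -> tr_form w Q q -> tr_form w (p_or P Q) (s_or p q).
Proof. intros <- <-. reflexivity. Qed.
Lemma tr_imp w P Q p q : tr_form w P p -> tr_form w Q q -> tr_form w (p_imp P Q) (s_imp p q).
Proof. intros <- <-. reflexivity. Qed.
Lemma tr_iff w P Q p q : tr_form w P p -> tr_form w Q q -> tr_form w (p_iff P Q) (s_iff p q).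
Proof. intros <- <-. reflexivity. Qed.

Lemma tr_all w F G : tr_fun w F G -> tr_form w (p_all F) (s_all G).
Proof.
  intros H. unfold tr_form, p_all. simpl. f_equal. apply functional_extensionality.
  intros v.
  apply (H (v :: w)); [exists [v]; reflexivity | apply denotes_level_new].
Qed.

Lemma tr_ex w F G : tr_fun w F G -> tr_form w (p_ex F) (s_ex G).
Proof.
  intros H. unfold tr_form, p_ex. simpl. f_equal. apply functional_extensionality.
  intros v.
  apply (H (v :: w)); [exists [v]; reflexivity | apply denotes_level_new].
Qed.

Lemma tr_mem w x y u v :
  denotes_level w x u -> denotes_level w y v -> tr_form w (p_mem x y) (memV u v).
Proof. intros [_ <-] [_ <-]. reflexivity. Qed.

Lemma tr_eq w x y u v :
  denotes_level w x u -> denotes_level w y v -> tr_form w (p_eq x y) (eqV u v).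
Proof. intros [_ <-] [_ <-]. reflexivity. Qed.

Lemma tr_bind w t s F G :
  tr_term w t s -> tr_fun w F G -> tr_form w (bind t F) (s_bind s G).
Proof.
  destruct t as [x | D], s as [v | E]; simpl; try tauto; intros Ht HF.
  - apply tr_fun_here; assumption.
  - apply tr_ex. intros w' E' x v D'. apply tr_and; [apply Ht | apply HF]; assumption.
Qed.

Lemma tr_var w x v : denotes_level w x v -> tr_term w (Var x) (SVar v).
Proof. trivial. Qed.

Lemma tr_the w D G : tr_fun w D G -> tr_term w (The D) (SThe G).
Proof. trivial. Qed.

Lemma tr_fun_intro w F G :
  (forall w' x v, extends w w' -> denotes_level w' x v -> tr_form w' (F x) (G v)) ->
  tr_fun w F G.
Proof. unfold tr_fun. auto. Qed.

End Translation.

Create HintDb translate discriminated.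
(* keeps the search from unfolding one notion into another *)
#[export] Hint Constants Opaque : translate.
#[export] Hint Resolve tr_bot tr_and tr_or tr_imp tr_iff tr_all tr_ex tr_mem tr_eq
  tr_bind tr_var tr_the : translate.

(** The hypotheses are carried to the extended environment, on which the body under the
    binder is evaluated. *)
Ltac tr_binder :=
  let w := fresh "w" in let x := fresh "x" in let v := fresh "v" in
  let E := fresh "E" in let D := fresh "D" in
  apply tr_fun_intro; intros w x v E D; cbv beta;
  repeat match goal with
  | H : denotes_level _ ?w0 _ _ |- _ =>
      match type of E with extends w0 _ => apply (denotes_level_mono _ _ _ _ _ E) in H end
  | H : tr_term _ ?w0 _ _ |- _ =>
      match type of E with extends w0 _ => apply (tr_term_mono _ _ _ _ _ E) in H end
  | H : tr_fun _ ?w0 _ _ |- _ =>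
      match type of E with extends w0 _ => apply (tr_fun_mono _ _ _ _ _ E) in H end
  end;
  clear E.
#[export] Hint Extern 1 (tr_fun _ _ _ _) => (assumption || tr_binder) : translate.
#[export] Hint Extern 1 (tr_form _ _ (?F _) (?G _)) =>
  (is_var F; apply tr_fun_here; assumption) : translate.

Ltac head_of P := match P with ?F _ => head_of F | _ => P end.
Ltac translate :=
  intros;
  match goal with
  | |- _ _ ?P ?Q => let p := head_of P in let q := head_of Q in unfold p, q
  end; eauto 40 with translate.

Section TranslationOfNotions.
Context {X : Space} (r : nat -> V X).
Implicit Types (w : list (V X)).
#[local] Notation tr_form := (tr_form r).
#[local] Notation tr_term := (tr_term r).
#[local] Notation tr_fun := (tr_fun r).
#[local] Notation denotes_level := (denotes_level r).

Lemma tr_t_mem w s t s' t' :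
  tr_term w s s' -> tr_term w t t' -> tr_form w (t_mem s t) (Sem.t_mem s' t').
Proof. unfold t_mem, Sem.t_mem. intros. eauto 10 with translate. Qed.
Hint Resolve tr_t_mem : translate.
Lemma tr_t_eq w s t s' t' :
  tr_term w s s' -> tr_term w t t' -> tr_form w (t_eq s t) (Sem.t_eq s' t').
Proof. unfold t_eq, Sem.t_eq. intros. eauto 10 with translate. Qed.
Hint Resolve tr_t_eq : translate.
Lemma tr_all_in w A A' F G :
  tr_term w A A' -> tr_fun w F G -> tr_form w (all_in A F) (Sem.all_in A' G).
Proof. unfold all_in, Sem.all_in. intros. eauto 10 with translate. Qed.
Hint Resolve tr_all_in : translate.
Lemma tr_ex_in w A A' F G :
  tr_term w A A' -> tr_fun w F G -> tr_form w (ex_in A F) (Sem.ex_in A' G).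
Proof. unfold ex_in, Sem.ex_in. intros. eauto 10 with translate. Qed.
Hint Resolve tr_ex_in : translate.

Lemma tr_Sub w x y x' y' :
  denotes_level w x x' -> denotes_level w y y' -> tr_form w (Sub x y) (Sem.Sub x' y').
Proof. translate. Qed.
#[local] Hint Resolve tr_Sub : translate.

Lemma tr_Transitive w x x' :
  denotes_level w x x' -> tr_form w (Transitive x) (Sem.Transitive x').
Proof. translate. Qed.
#[local] Hint Resolve tr_Transitive : translate.

Lemma tr_Zero w :
  tr_term w Zero Sem.Zero.
Proof. translate. Qed.
#[local] Hint Resolve tr_Zero : translate.

Lemma tr_Succ w s s' :
  tr_term w s s' -> tr_term w (Succ s) (Sem.Succ s').
Proof. translate. Qed.
#[local] Hint Resolve tr_Succ : translate.

Lemma tr_Inductive_set w x x' :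
  denotes_level w x x' -> tr_form w (Inductive_set x) (Sem.Inductive_set x').
Proof. translate. Qed.
#[local] Hint Resolve tr_Inductive_set : translate.

Lemma tr_Omega w :
  tr_term w Omega Sem.Omega.
Proof. translate. Qed.
#[local] Hint Resolve tr_Omega : translate.

Lemma tr_UPair w s t s' t' :
  tr_term w s s' -> tr_term w t t' -> tr_term w (UPair s t) (Sem.UPair s' t').
Proof. translate. Qed.
#[local] Hint Resolve tr_UPair : translate.

Lemma tr_OPair w s t s' t' :
  tr_term w s s' -> tr_term w t t' -> tr_term w (OPair s t) (Sem.OPair s' t').
Proof. translate. Qed.
#[local] Hint Resolve tr_OPair : translate.

Lemma tr_Function w f s t f' s' t' :
  denotes_level w f f' -> tr_term w s s' -> tr_term w t t' -> tr_form w (Function f s t) (Sem.Function f' s' t').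
Proof. translate. Qed.
#[local] Hint Resolve tr_Function : translate.

Lemma tr_App w s t s' t' :
  tr_term w s s' -> tr_term w t t' -> tr_term w (App s t) (Sem.App s' t').
Proof. translate. Qed.
#[local] Hint Resolve tr_App : translate.

Lemma tr_One w :
  tr_term w One Sem.One.
Proof. translate. Qed.
#[local] Hint Resolve tr_One : translate.

Lemma tr_Add w s t s' t' :
  tr_term w s s' -> tr_term w t t' -> tr_term w (Add s t) (Sem.Add s' t').
Proof. translate. Qed.
#[local] Hint Resolve tr_Add : translate.

Lemma tr_Mul w s t s' t' :
  tr_term w s s' -> tr_term w t t' -> tr_term w (Mul s t) (Sem.Mul s' t').
Proof. translate. Qed.
#[local] Hint Resolve tr_Mul : translate.

Lemma tr_Frac w s t q s' t' q' :
  tr_term w s s' -> tr_term w t t' -> tr_term w q q' -> tr_term w (Frac s t q) (Sem.Frac s' t' q').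
Proof. translate. Qed.
#[local] Hint Resolve tr_Frac : translate.

Lemma tr_Rationals w :
  tr_term w Rationals Sem.Rationals.
Proof. translate. Qed.
#[local] Hint Resolve tr_Rationals : translate.

Lemma tr_RLt w s t s' t' :
  tr_term w s s' -> tr_term w t t' -> tr_form w (RLt s t) (Sem.RLt s' t').
Proof. translate. Qed.
#[local] Hint Resolve tr_RLt : translate.

Lemma tr_RAdd w s t s' t' :
  tr_term w s s' -> tr_term w t t' -> tr_term w (RAdd s t) (Sem.RAdd s' t').
Proof. translate. Qed.
#[local] Hint Resolve tr_RAdd : translate.

Lemma tr_ROpp w s s' :
  tr_term w s s' -> tr_term w (ROpp s) (Sem.ROpp s').
Proof. translate. Qed.
#[local] Hint Resolve tr_ROpp : translate.

Lemma tr_RSub w s t s' t' :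
  tr_term w s s' -> tr_term w t t' -> tr_term w (RSub s t) (Sem.RSub s' t').
Proof. translate. Qed.
#[local] Hint Resolve tr_RSub : translate.

Lemma tr_RZero w :
  tr_term w RZero Sem.RZero.
Proof. translate. Qed.
#[local] Hint Resolve tr_RZero : translate.

Lemma tr_RAbs w s s' :
  tr_term w s s' -> tr_term w (RAbs s) (Sem.RAbs s').
Proof. translate. Qed.
#[local] Hint Resolve tr_RAbs : translate.

Lemma tr_RInv w s s' :
  tr_term w s s' -> tr_term w (RInv s) (Sem.RInv s').
Proof. translate. Qed.
#[local] Hint Resolve tr_RInv : translate.

Lemma tr_PosRationals w :
  tr_term w PosRationals Sem.PosRationals.
Proof. translate. Qed.
#[local] Hint Resolve tr_PosRationals : translate.

Lemma tr_Cauchy w x x' :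
  denotes_level w x x' -> tr_form w (Cauchy x) (Sem.Cauchy x').
Proof. translate. Qed.
#[local] Hint Resolve tr_Cauchy : translate.

Lemma tr_Modulus w f x f' x' :
  denotes_level w f f' -> denotes_level w x x' -> tr_form w (Modulus f x) (Sem.Modulus f' x').
Proof. translate. Qed.
#[local] Hint Resolve tr_Modulus : translate.

Lemma tr_Dist w s t s' t' :
  tr_term w s s' -> tr_term w t t' -> tr_term w (Dist s t) (Sem.Dist s' t').
Proof. translate. Qed.
#[local] Hint Resolve tr_Dist : translate.

Lemma tr_SeqLt w s t s' t' :
  tr_term w s s' -> tr_term w t t' -> tr_form w (SeqLt s t) (Sem.SeqLt s' t').
Proof. translate. Qed.
#[local] Hint Resolve tr_SeqLt : translate.

Lemma tr_Const w s s' :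
  tr_term w s s' -> tr_term w (Const s) (Sem.Const s').
Proof. translate. Qed.
#[local] Hint Resolve tr_Const : translate.

Lemma tr_CauchySequences w :
  tr_term w CauchySequences Sem.CauchySequences.
Proof. translate. Qed.
#[local] Hint Resolve tr_CauchySequences : translate.

Lemma tr_CauchySeqOfSeqs w x x' :
  denotes_level w x x' -> tr_form w (CauchySeqOfSeqs x) (Sem.CauchySeqOfSeqs x').
Proof. translate. Qed.
#[local] Hint Resolve tr_CauchySeqOfSeqs : translate.

Lemma tr_ModulusOfSeqs w f x f' x' :
  denotes_level w f f' -> denotes_level w x x' -> tr_form w (ModulusOfSeqs f x) (Sem.ModulusOfSeqs f' x').
Proof. translate. Qed.
#[local] Hint Resolve tr_ModulusOfSeqs : translate.

Lemma tr_ConvergesTo w x y x' y' :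
  denotes_level w x x' -> denotes_level w y y' -> tr_form w (ConvergesTo x y) (Sem.ConvergesTo x' y').
Proof. translate. Qed.
#[local] Hint Resolve tr_ConvergesTo : translate.

Lemma tr_cauchy_completeness : ev cauchy_completeness r = Sem.cauchy_completeness.
Proof.
  unfold cauchy_completeness, sentence, Sem.cauchy_completeness.
  match goal with |- ev (?P 0) _ = ?phi => change (tr_form [] P phi) end.
  eauto 40 with translate.
Qed.

End TranslationOfNotions.

#[export] Hint Resolve tr_t_mem tr_t_eq tr_all_in tr_ex_in tr_Transitive : translate.

(** * Descriptions in the model *)

(** Reasoning near a point: an open fact, or one that holds near the point, becomes an
    assumption at the nearby points. *)
Ltac keep H :=
  lazymatch goal with |- box _ _ => idtac | _ => hnf end;
  first [refine (box_keep _ _ _ H _) | refine (box_keep_box _ _ _ H _)].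

Section Descriptions.
Context {X : Space}.
Implicit Types (x y z u v : V X) (s t : pt) (a b : sterm X) (D F P : V X -> Open X).

Lemma s_iff_spec (P Q : Open X) t : s_iff P Q t <-> box (fun s => P s <-> Q s) t.
Proof.
  split.
  - intros [H1 H2]. generalize (box_and _ _ _ H1 H2). apply box_mono. intros s. split; apply H.
  - intros H. split; revert H; apply box_mono; intros s H; apply H.
Qed.

(** The description denotes [v] near the point: a variable by being equal to [v],
    a description proper by being satisfied by [v] alone. *)
Definition den (a : sterm X) (v : V X) : Open X :=
  interior (fun s => match a with
    | SVar x => eqV x v s
    | SThe D => forall z, D z s <-> eqV z v s
    end).

(** Elements that are equal to [v] are allowed for [z], so that no congruence property of
    [F] has to be proved. *)
Lemma s_bind_den a (F : V X -> Open X) v t (phi : Prop) :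
  den a v t -> (forall z, eqV z v t -> (F z t <-> phi)) -> (s_bind a F t <-> phi).
Proof.
  intros H HF. apply box_incl in H. destruct a as [x | D]; simpl in *.
  - auto.
  - split.
    + intros [z [Hz Fz]]. apply H in Hz. apply (HF z Hz), Fz.
    + intros Hphi. exists v. split; [apply H, eqV_refl | apply (HF v (eqV_refl v t)), Hphi].
Qed.

Lemma den_var x v t : eqV x v t -> den (SVar x) v t.
Proof. apply holds_near. Qed.

Lemma den_var_inv x v t : den (SVar x) v t -> eqV x v t.
Proof. apply box_incl. Qed.

Lemma den_refl x t : den (SVar x) x t.
Proof. apply den_var, eqV_refl. Qed.

Lemma den_the D v t : box (fun s => forall z, D z s <-> eqV z v s) t -> den (SThe D) v t.
Proof. trivial. Qed.

Lemma den_eq a v w t : den a v t -> eqV v w t -> den a w t.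
Proof.
  intros H E. keep E. keep H. apply box_all. intros s H' E'. apply box_incl in H'. destruct a as [x | D].
  - eauto using eqV_trans.
  - intros z. rewrite H'. split; eauto using eqV_trans, eqV_sym.
Qed.

Lemma den_unique a v w t : den a v t -> den a w t -> eqV v w t.
Proof.
  intros H1 H2. apply box_incl in H1, H2. destruct a as [x | D].
  - eauto using eqV_trans, eqV_sym.
  - apply H2, H1, eqV_refl.
Qed.

Lemma t_mem_den a b u v t : den a u t -> den b v t -> (Sem.t_mem a b t <-> memV u v t).
Proof.
  intros Ha Hb. apply (s_bind_den _ _ u); [assumption|]. intros x Ex.
  apply (s_bind_den _ _ v); [assumption|]. intros y Ey.
  split; intros H.
  - eapply memV_eq_l; [exact Ex|]. eapply memV_eq_r; eassumption.
  - eapply memV_eq_l; [apply eqV_sym; exact Ex|]. eapply memV_eq_r; [apply eqV_sym|]; eassumption.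
Qed.

Lemma t_eq_den a b u v t : den a u t -> den b v t -> (Sem.t_eq a b t <-> eqV u v t).
Proof.
  intros Ha Hb. apply (s_bind_den _ _ u); [assumption|]. intros x Ex.
  apply (s_bind_den _ _ v); [assumption|]. intros y Ey.
  split; eauto using eqV_trans, eqV_sym.
Qed.

Lemma t_mem_var x b v t : den b v t -> (Sem.t_mem (SVar x) b t <-> memV x v t).
Proof. apply t_mem_den, den_refl. Qed.

(** A set described by its elements is unique by extensionality. *)
Lemma described_by_elements (P : V X -> Open X) v z t :
  box (fun s => forall u, P u s <-> memV u v s) t ->
  (@s_all _ (V X) (fun u => s_iff (memV u z) (P u)) t <-> eqV z v t).
Proof.
  intros H. split.
  - intros Hz. apply eqV_ext. keep H. simpl in Hz. keep Hz. apply box_all.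
    intros s Hz' H' u. apply box_incl in Hz', H'. rewrite <- (H' u).
    apply box_incl with (P := fun s => memV u z s <-> P u s). apply s_iff_spec, Hz'.
  - intros E. simpl. keep E. keep H. apply box_all. intros s H' E' u. apply s_iff_spec.
    keep E'. keep H'. apply box_all. clear s H' E'. intros s H' E'.
    apply box_incl in H'. rewrite (H' u).
    split; apply memV_eq_r; [|apply eqV_sym]; assumption.
Qed.

Lemma den_by_elements (P : V X -> Open X) v t :
  box (fun s => forall u, P u s <-> memV u v s) t ->
  den (SThe (fun z => @s_all _ (V X) (fun u => s_iff (memV u z) (P u)))) v t.
Proof.
  intros H. apply den_the. keep H. apply box_all. intros s H' z.
  apply described_by_elements, H'.
Qed.

End Descriptions.

(** * Pairs and natural numbers in the model *)

Section Names.
Context {X : Space}.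
Implicit Types (x y z u v : V X) (s t : pt) (a b : sterm X) (D F P : V X -> Open X).

Lemma all_in_den (A : sterm X) v F t :
  den A v t -> (Sem.all_in A F t <-> box (fun s => forall x, memV x v s -> F x s) t).
Proof.
  intros HA. split; intros H.
  - keep HA. simpl in H. keep H. apply box_all. intros s H' HA' x Hx.
    apply box_incl in H'. specialize (H' x). apply box_incl in H'. apply H'.
    apply (t_mem_var x A v); assumption.
  - simpl. keep HA. keep H. apply box_all. intros s H' HA' x.
    keep HA'. keep H'. apply box_all. clear s H' HA'. intros s H' HA' Hx.
    apply box_incl in H'. apply H'. apply (t_mem_var x A v); assumption.
Qed.

Lemma ex_in_den (A : sterm X) v F t :
  den A v t -> (Sem.ex_in A F t <-> exists x, memV x v t /\ F x t).
Proof.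
  intros HA. split; intros [x [H1 H2]]; exists x; (split; [|assumption]);
    apply (t_mem_var x A v); assumption.
Qed.

Definition famV {A : Type} (f : A -> V X) : V X := sup A f (fun _ => s_prop True).

Lemma memV_famV {A : Type} (f : A -> V X) x t : memV x (famV f) t <-> exists i, eqV x (f i) t.
Proof.
  split.
  - intros [i [_ H]]. eauto.
  - intros [i H]. exists i. split; [exact I | exact H].
Qed.

Definition pairV x y : V X := famV (fun b : bool => if b then x else y).

Lemma memV_pairV z x y t : memV z (pairV x y) t <-> eqV z x t \/ eqV z y t.
Proof.
  unfold pairV. rewrite memV_famV. split.
  - intros [[|] H]; auto.
  - intros [H | H]; [exists true | exists false]; assumption.
Qed.

Definition opairV x y : V X := pairV (pairV x x) (pairV x y).

Lemma pairV_congr x y x' y' t : eqV x x' t -> eqV y y' t -> eqV (pairV x y) (pairV x' y') t.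
Proof.
  intros Hx Hy. apply eqV_ext. keep Hx. keep Hy. apply box_all. intros s Hy' Hx' z.
  rewrite !memV_pairV. split; intros [H | H]; eauto using eqV_trans, eqV_sym.
Qed.

Lemma pairV_cases x y x' y' t :
  eqV (pairV x y) (pairV x' y') t ->
  (eqV x x' t \/ eqV x y' t) /\ (eqV y x' t \/ eqV y y' t) /\
  (eqV x x' t \/ eqV y x' t) /\ (eqV x y' t \/ eqV y y' t).
Proof.
  intros H. repeat split.
  - apply memV_pairV. eapply memV_eq_r; [exact H|]. apply memV_pairV. left. apply eqV_refl.
  - apply memV_pairV. eapply memV_eq_r; [exact H|]. apply memV_pairV. right. apply eqV_refl.
  - assert (E : memV x' (pairV x y) t).
    { eapply memV_eq_r; [apply eqV_sym, H|]. apply memV_pairV. left. apply eqV_refl. }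
    apply memV_pairV in E. destruct E; [left | right]; apply eqV_sym; assumption.
  - assert (E : memV y' (pairV x y) t).
    { eapply memV_eq_r; [apply eqV_sym, H|]. apply memV_pairV. right. apply eqV_refl. }
    apply memV_pairV in E. destruct E; [left | right]; apply eqV_sym; assumption.
Qed.

Lemma opairV_eq x y x' y' t :
  eqV (opairV x y) (opairV x' y') t <-> eqV x x' t /\ eqV y y' t.
Proof.
  split.
  - intros H. apply pairV_cases in H. destruct H as [H1 [H2 [_ H4]]].
    assert (Ex : eqV x x' t).
    { destruct H1 as [H | H]; apply pairV_cases in H;
      destruct H as [[H | H] [_ [[H' | H'] _]]]; assumption. }
    split; [exact Ex|].
    (* the cases in which a pair collapses to a singleton force x = y or x' = y' *)
    assert (Hyx : eqV y x' t \/ eqV y y' t).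
    { destruct H2 as [H | H]; apply pairV_cases in H; tauto. }
    assert (Hxy : eqV x y' t \/ eqV y y' t).
    { destruct H4 as [H | H]; apply pairV_cases in H; tauto. }
    destruct Hyx as [Hyx | ]; [|assumption]. destruct Hxy as [Hxy | ]; [|assumption].
    eauto using eqV_trans, eqV_sym.
  - intros [Hx Hy]. unfold opairV. auto using pairV_congr.
Qed.

Lemma den_UPair a b x y t : den a x t -> den b y t -> den (Sem.UPair a b) (pairV x y) t.
Proof.
  intros Ha Hb. apply den_the. keep Ha. keep Hb. apply box_all. clear t Ha Hb.
  intros s Hb Ha z.
  apply (s_bind_den _ _ x); [assumption|]. intros x' Ex.
  apply (s_bind_den _ _ y); [assumption|]. intros y' Ey.
  apply described_by_elements. keep Ex. keep Ey. apply box_all. intros s' Ey' Ex' u.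
  rewrite memV_pairV. simpl. split; intros [H | H]; eauto using eqV_trans, eqV_sym.
Qed.

Lemma den_OPair a b x y t : den a x t -> den b y t -> den (Sem.OPair a b) (opairV x y) t.
Proof.
  intros Ha Hb. apply den_the. keep Ha. keep Hb. apply box_all. clear t Ha Hb.
  intros s Hb Ha z.
  apply (s_bind_den _ _ x); [assumption|]. intros x' Ex.
  apply (s_bind_den _ _ y); [assumption|]. intros y' Ey.
  apply t_eq_den; [apply den_refl|]. apply den_UPair; apply den_UPair; apply den_var; assumption.
Qed.

Definition succV x : V X :=
  match x with
  | sup A f e => sup (option A) (fun o => match o with Some i => f i | None => x end)
                   (fun o => match o with Some i => e i | None => s_prop True end)
  end.

Lemma memV_succV y x t : memV y (succV x) t <-> memV y x t \/ eqV y x t.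
Proof.
  destruct x as [A f e]. split.
  - intros [[i | ] [H1 H2]]; [left; exists i; split | right]; assumption.
  - intros [[i [H1 H2]] | H]; [exists (Some i) | exists None]; split; trivial. exact I.
Qed.

Lemma succV_congr x y t : eqV x y t -> eqV (succV x) (succV y) t.
Proof.
  intros H. apply eqV_ext. keep H. apply box_all. intros s H' z. rewrite !memV_succV.
  split; intros [Hz | Hz]; eauto using memV_eq_r, eqV_sym, eqV_trans.
Qed.

Fixpoint nm (n : nat) : V X := match n with 0 => emptyV | S n => succV (nm n) end.

Lemma memV_nm x n t : memV x (nm n) t <-> exists k, k < n /\ eqV x (nm k) t.
Proof.
  induction n as [|n IH]; simpl nm.
  - split; [intros [[]] | intros [k [Hk _]]; lia].
  - rewrite memV_succV, IH. split.
    + intros [[k [Hk E]] | E]; [exists k | exists n]; auto.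
    + intros [k [Hk E]]. destruct (Nat.eq_dec k n) as [-> | Hn]; [auto|].
      left. exists k. split; [lia | assumption].
Qed.

Lemma nm_irrefl n t : ~ memV (nm n) (nm n) t.
Proof.
  induction n as [n IH] using lt_wf_ind. intros H.
  assert (H' := H). apply memV_nm in H'. destruct H' as [k [Hk E]].
  apply (IH k Hk). eapply memV_eq_l; [exact E|]. eapply memV_eq_r; [exact E | exact H].
Qed.

Lemma nm_mem m n t : memV (nm m) (nm n) t <-> m < n.
Proof.
  split; intros H.
  - destruct (le_lt_dec n m) as [Hn | ]; [exfalso | assumption].
    apply memV_nm in H. destruct H as [k [Hk E]]. apply (nm_irrefl k t).
    eapply memV_eq_r; [exact E|]. apply memV_nm. exists k. split; [lia | apply eqV_refl].
  - apply memV_nm. exists m. split; [assumption | apply eqV_refl].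
Qed.

Lemma nm_eq m n t : eqV (nm m) (nm n) t <-> m = n.
Proof.
  split; [|intros ->; apply eqV_refl]. intros H.
  destruct (Nat.lt_trichotomy m n) as [L | [ | L]]; [|assumption|]; exfalso;
    apply (nm_mem _ _ t) in L; eapply nm_irrefl.
  - eapply memV_eq_r; [apply eqV_sym, H | exact L].
  - eapply memV_eq_r; [apply H | exact L].
Qed.

Lemma den_Zero t : den Sem.Zero (nm 0) t.
Proof.
  apply den_the, box_all. clear t. intros t z. split; intros H.
  - apply eqV_ext. simpl in H. keep H. apply box_all. intros s H' y. apply box_incl in H'.
    specialize (H' y). apply box_incl in H'. split; [contradiction | intros [[]]].
  - simpl. keep H. apply box_all. intros s H' y. keep H'. apply box_all. clear s H'.
    intros s H' Hy. apply (memV_eq_r _ _ _ _ H') in Hy. destruct Hy as [[]].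
Qed.

Lemma den_Succ a x t : den a x t -> den (Sem.Succ a) (succV x) t.
Proof.
  intros Ha. apply den_the. keep Ha. apply box_all. clear t Ha. intros t Ha z.
  apply (s_bind_den _ _ x); [assumption|]. intros x' Ex.
  apply described_by_elements. keep Ex. apply box_all. intros s Ex' u.
  rewrite memV_succV. simpl.
  split; intros [H | H]; eauto using memV_eq_r, eqV_trans, eqV_sym.
Qed.

Definition omegaV : V X := famV nm.

Lemma Inductive_set_spec w t :
  Sem.Inductive_set w t <->
  box (fun s => memV (nm 0) w s /\ forall x, memV x w s -> memV (succV x) w s) t.
Proof.
  change ((Sem.t_mem Sem.Zero (SVar w) t /\
    Sem.all_in (SVar w) (fun x => Sem.t_mem (Sem.Succ (SVar x)) (SVar w)) t) <->
    box (fun s => memV (nm 0) w s /\ (forall x, memV x w s -> memV (succV x) w s)) t).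
  rewrite (all_in_den _ w) by apply den_refl.
  assert (HS : forall x s, Sem.t_mem (Sem.Succ (SVar x)) (SVar w) s <-> memV (succV x) w s).
  { intros x s. apply t_mem_den; [apply den_Succ|]; apply den_refl. }
  rewrite (t_mem_den _ _ (nm 0) w) by (apply den_Zero || apply den_refl).
  split.
  - intros [H1 H2]. apply box_and; [apply holds_near; assumption|].
    revert H2. apply box_mono. intros s H x. rewrite <- HS. apply H.
  - intros H. split; [apply (box_incl _ _ H)|]. revert H. apply box_mono. intros s [_ H] x.
    rewrite HS. apply H.
Qed.

Lemma Inductive_set_nm w n t : Sem.Inductive_set w t -> memV (nm n) w t.
Proof.
  rewrite Inductive_set_spec. intros H. apply box_incl in H. destruct H as [H0 HS].
  induction n as [|n IH]; [assumption | apply HS, IH].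
Qed.

Lemma Inductive_set_omegaV t : Sem.Inductive_set omegaV t.
Proof.
  apply Inductive_set_spec, box_all. intros s. split.
  - apply memV_famV. exists 0. apply eqV_refl.
  - intros x Hx. apply memV_famV in Hx. destruct Hx as [n Hn]. apply memV_famV.
    exists (S n). apply succV_congr, Hn.
Qed.

Lemma Sub_spec x y t : Sem.Sub x y t <-> box (fun s => forall z, memV z x s -> memV z y s) t.
Proof. apply (all_in_den _ x), den_refl. Qed.

Lemma den_Omega t : den Sem.Omega omegaV t.
Proof.
  apply den_the, box_all. clear t. intros t z. split.
  - intros [H1 H2]. apply eqV_ext. keep H1. simpl in H2. keep H2. apply box_all.
    intros s H2' H1' u. apply box_incl in H2'. specialize (H2' omegaV).
    apply box_incl in H2'. specialize (H2' (Inductive_set_omegaV s)).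
    apply Sub_spec, box_incl in H2'. split; [apply H2'|].
    intros Hu. apply memV_famV in Hu. destruct Hu as [n Hn].
    eapply memV_eq_l; [apply eqV_sym, Hn|]. apply Inductive_set_nm, H1'.
  - intros E. split.
    + apply Inductive_set_spec. keep E. apply box_all. intros s E'.
      assert (H := Inductive_set_omegaV s). apply Inductive_set_spec, box_incl in H.
      split.
      * eapply memV_eq_r; [apply eqV_sym, E' | apply H].
      * intros x Hx. eapply memV_eq_r; [apply eqV_sym, E'|]. apply H.
        eapply memV_eq_r; [apply E' | assumption].
    + change (box (fun s => forall w, box (fun s' => Sem.Inductive_set w s' -> Sem.Sub z w s') s) t).
      keep E. apply box_all. intros s E' w. keep E'. apply box_all. clear s E'.
      intros s E' Hw. apply Sub_spec. keep E'. keep Hw. apply box_all. clear s Hw E'.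
      intros s Hw E' u Hu. apply (memV_eq_r _ _ _ _ E') in Hu. apply memV_famV in Hu.
      destruct Hu as [n Hn]. eapply memV_eq_l; [apply eqV_sym, Hn|].
      apply Inductive_set_nm, Hw.
Qed.

End Names.

(** * Closing a family under witnesses *)

Section Reflecting.
Context {X : Space}.
Implicit Types (x y z u v W : V X) (s t : pt) (r : nat -> V X).

Fixpoint ev_rel W (phi : form) r : Open X :=
  match phi with
  | Bot => s_false
  | Mem i j => memV (r i) (r j)
  | Eq i j => eqV (r i) (r j)
  | And a b => s_and (ev_rel W a r) (ev_rel W b r)
  | Or a b => s_or (ev_rel W a r) (ev_rel W b r)
  | Imp a b => s_imp (ev_rel W a r) (ev_rel W b r)
  | All a => s_all (fun x => s_imp (memV x W) (ev_rel W a (scons x r)))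
  | Ex a => s_ex (fun x => s_and (memV x W) (ev_rel W a (scons x r)))
  end.

Lemma ev_relativize f k phi r :
  ev (relativize k (rename f phi)) r = ev_rel (r k) phi (fun i => r (f i)).
Proof.
  revert f k r. induction phi; intros f k r; simpl; try reflexivity;
    try (rewrite IHphi1, IHphi2; reflexivity);
    f_equal; apply functional_extensionality; intros x; rewrite IHphi; simpl;
    repeat f_equal; apply functional_extensionality; intros [|i]; reflexivity.
Qed.

Lemma ev_rel_congr W phi r r' t :
  box (fun s => forall i, eqV (r i) (r' i) s) t -> ev_rel W phi r t -> ev_rel W phi r' t.
Proof.
  intros E.
  assert (H : forall q, ev_rel W phi q = ev (relativize 0 (rename S phi)) (scons W q)).
  { intros q. symmetry. apply (ev_relativize S 0 phi (scons W q)). }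
  rewrite !H.
  apply ev_congr. revert E. apply box_mono. intros s E [|i]; [apply eqV_refl | apply E].
Qed.

Lemma ev_rel_congr1 W phi x y r t :
  eqV x y t -> ev_rel W phi (scons x r) t -> ev_rel W phi (scons y r) t.
Proof.
  intros E. apply ev_rel_congr. keep E. apply box_all.
  intros s H [|i]; [assumption | apply eqV_refl].
Qed.

Lemma ev_free phi n r r' :
  free_below n phi -> (forall i, i < n -> r i = r' i) -> ev phi r = ev phi r'.
Proof.
  revert n r r'. induction phi; intros k r r' Hn H; simpl in *;
    try match type of Hn with _ /\ _ => destruct Hn as [Hn1 Hn2] end;
    try (rewrite (H _ Hn1), (H _ Hn2); reflexivity);
    try (rewrite (IHphi1 k r r'), (IHphi2 k r r') by assumption; reflexivity);
    try reflexivity;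
    f_equal; apply functional_extensionality; intros x; apply (IHphi (S k)); trivial;
    intros [|i] Hi; simpl; auto with arith.
Qed.

Lemma ev_rel_free W phi n r r' :
  free_below n phi -> (forall i, i < n -> r i = r' i) -> ev_rel W phi r = ev_rel W phi r'.
Proof.
  revert n r r'. induction phi; intros k r r' Hn H; simpl in *;
    try match type of Hn with _ /\ _ => destruct Hn as [Hn1 Hn2] end;
    try (rewrite (H _ Hn1), (H _ Hn2); reflexivity);
    try (rewrite (IHphi1 k r r'), (IHphi2 k r r') by assumption; reflexivity);
    try reflexivity;
    f_equal; apply functional_extensionality; intros x;
    rewrite (IHphi (S k) (scons x r) (scons x r')); trivial;
    intros [|i] Hi; simpl; auto with arith.
Qed.

Definition lenv (vs : list (V X)) (i : nat) : V X := nth i vs emptyV.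

Lemma lenv_cons v vs : lenv (v :: vs) = scons v (lenv vs).
Proof. apply functional_extensionality. intros [|i]; reflexivity. Qed.

(** The hypothesis of the Tarski-Vaught criterion. Existential statements are true
    pointwise, and a universal statement is true at a point if all its instances are true
    near the point; so one witness, or counterexample, for each point is enough. *)
Definition witnessing {I : Type} (f : I -> V X) : Prop :=
  forall a l t,
    (forall x, ev a (scons x (lenv (map f l))) t ->
       exists i, ev a (lenv (map f (i :: l))) t) /\
    (forall x, ~ ev a (scons x (lenv (map f l))) t ->
       exists i, ~ ev a (lenv (map f (i :: l))) t).

Lemma witnessing_reflects {I : Type} (f : I -> V X) : witnessing f ->
  forall a l t, ev_rel (famV f) a (lenv (map f l)) t <-> ev a (lenv (map f l)) t.
Proof.
  intros Hf. induction a; intros l t; simpl; try tauto.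
  - rewrite IHa1, IHa2. tauto.
  - rewrite IHa1, IHa2. tauto.
  - split; apply box_mono; intros s; rewrite IHa1, IHa2; trivial.
  - split; intros H.
    + revert H. apply box_mono. intros s H x.
      apply NNPP. intros Hx. destruct (proj2 (Hf a l s) x Hx) as [i Hi]. apply Hi.
      apply IHa. simpl. rewrite lenv_cons.
      apply (box_incl _ _ (H (f i))). apply memV_famV. exists i. apply eqV_refl.
    + keep H. apply box_all. intros s H' x. keep H'. apply box_all.
      clear s H'. intros s H' Hx. apply memV_famV in Hx. destruct Hx as [i Hi].
      eapply ev_rel_congr1; [apply eqV_sym, Hi|]. rewrite <- lenv_cons.
      apply (IHa (i :: l)). simpl. rewrite lenv_cons. apply (box_incl _ _ H').
  - split.
    + intros [x [Hx Ha]]. apply memV_famV in Hx. destruct Hx as [i Hi]. exists (f i).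
      rewrite <- lenv_cons. apply (IHa (i :: l)). simpl. rewrite lenv_cons.
      eapply ev_rel_congr1; eassumption.
    + intros [x Ha]. destruct (proj1 (Hf a l t) x Ha) as [i Hi]. exists (f i).
      split; [apply memV_famV; exists i; apply eqV_refl|].
      rewrite <- lenv_cons. apply (IHa (i :: l)), Hi.
Qed.

Record family := { idx : Type; elt : idx -> V X }.

Definition child_idx x : Type := match x with sup A _ _ => A end.
Definition child x : child_idx x -> V X := match x with sup A f _ => f end.

(** A witness of an existential statement if [b] is true, else a counterexample to a
    universal one. *)
Definition witness (b : bool) (a : form) (vs : list (V X)) t : V X :=
  epsilon (inhabits emptyV)
    (fun x => if b then ev a (scons x (lenv vs)) t else ~ ev a (scons x (lenv vs)) t).

(** The elements make the hull transitive, the witnesses make it reflecting.  Witnesses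
    are indexed by formulas, lists and points, so the index type stays small. *)
Definition step (F : family) : family :=
  {| idx := idx F + {i : idx F & child_idx (elt F i)} + (bool * form * list (idx F) * pt);
     elt := fun j => match j with
       | inl (inl i) => elt F i
       | inl (inr (existT _ i c)) => child (elt F i) c
       | inr (b, a, l, t) => witness b a (map (elt F) l) t
       end |}.

Definition stage (F : family) (n : nat) : family := Nat.iter n step F.

Definition hull (F : family) : {n : nat & idx (stage F n)} -> V X :=
  fun p => elt (stage F (projT1 p)) (projT2 p).

Lemma stage_lift F n m (i : idx (stage F n)) : n <= m ->
  exists j : idx (stage F m), elt (stage F m) j = elt (stage F n) i.
Proof.
  intros H. induction H as [|m H [j Hj]]; [exists i; reflexivity|].
  exists (inl (inl j)). exact Hj.
Qed.

(** Parameters are finitely many, so they all occur at a common stage. *)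
Lemma hull_list F l : exists n (l' : list (idx (stage F n))),
  map (hull F) l = map (elt (stage F n)) l'.
Proof.
  assert (Hlift : forall n m (l : list (idx (stage F n))), n <= m ->
    exists l', map (elt (stage F m)) l' = map (elt (stage F n)) l).
  { intros n m l0 H. induction l0 as [|i l0 [l' IH]]; [exists []; reflexivity|].
    destruct (stage_lift F n m i H) as [j Hj]. exists (j :: l'). simpl. congruence. }
  induction l as [|[m i] l [n [l' IH]]]; [exists 0, []; reflexivity|].
  destruct (Hlift n (n + m) l') as [l'' Hl]; [lia|].
  destruct (stage_lift F m (n + m) i) as [j Hj]; [lia|].
  exists (n + m), (j :: l''). simpl. unfold hull at 1. simpl. congruence.
Qed.

Lemma hull_witnessing F : witnessing (hull F).
Proof.
  intros a l t. destruct (hull_list F l) as [n [l' Hl]]. rewrite !Hl.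
  split; intros x Hx.
  - exists (existT _ (S n) (inr (true, a, l', t))). rewrite map_cons, lenv_cons, Hl.
    apply (epsilon_spec (inhabits emptyV)
      (fun x => ev a (scons x (lenv (map (elt (stage F n)) l'))) t)). eauto.
  - exists (existT _ (S n) (inr (false, a, l', t))). rewrite map_cons, lenv_cons, Hl.
    apply (epsilon_spec (inhabits emptyV)
      (fun x => ~ ev a (scons x (lenv (map (elt (stage F n)) l'))) t)). eauto.
Qed.

Lemma hull_transitive F t : Sem.Transitive (famV (hull F)) t.
Proof.
  unfold Sem.Transitive. rewrite (all_in_den _ (famV (hull F))) by apply den_refl.
  apply box_all. clear t. intros t y Hy. apply Sub_spec. keep Hy. apply box_all.
  clear t Hy. intros t Hy z Hz. apply memV_famV in Hy. destruct Hy as [[n i] Hi].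
  apply (memV_eq_r _ _ _ _ Hi) in Hz. unfold hull in Hz. simpl in Hz.
  apply memV_famV.
  assert (Hc : exists c, eqV z (child (elt (stage F n) i) c) t).
  { destruct (elt (stage F n) i) as [A f e]. destruct Hz as [c [_ Hc]]. eauto. }
  destruct Hc as [c Hc]. exists (existT _ (S n) (inl (inr (existT _ i c)))). exact Hc.
Qed.

Lemma hull_base F (i : idx F) t : memV (elt F i) (famV (hull F)) t.
Proof. apply memV_famV. exists (existT _ 0 i). apply eqV_refl. Qed.

End Reflecting.

(** * The axioms hold in the model *)

Section Validity.
Context {X : Space}.
Implicit Types (x y z u v W : V X) (s t : pt) (r : nat -> V X).

Lemma Extensionality_valid r t : ev (sentence Extensionality) r t.
Proof.
  simpl. apply box_all. clear t. intros t x. apply box_all. clear t. intros t y.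
  apply box_all. clear t. intros t H. apply eqV_ext. keep H. apply box_all. clear t H.
  intros t H z. apply box_incl in H. destruct (H z) as [H1 H2].
  split; [apply (box_incl _ _ H1) | apply (box_incl _ _ H2)].
Qed.

Lemma EmptySet_valid r t : ev (sentence EmptySet) r t.
Proof.
  exists emptyV. simpl. apply box_all. clear t. intros t y. apply box_all. intros s [[]].
Qed.

Lemma s_iff_all (P Q : Open X) t : (forall s, P s <-> Q s) -> s_iff P Q t.
Proof. intros H. apply s_iff_spec, box_all, H. Qed.

Lemma Pairing_valid r t : ev (sentence Pairing) r t.
Proof.
  simpl. apply box_all. clear t. intros t x. apply box_all. clear t. intros t y.
  exists (pairV x y). apply box_all. clear t. intros t z.
  refine (s_iff_all (memV _ _) (s_or (eqV _ _) (eqV _ _)) t _). intros s.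
  apply memV_pairV.
Qed.

(** The children of a child are weighted by their membership in it, which avoids an
    analysis of the child. *)
Definition unionV x : V X :=
  match x with
  | sup A f e =>
      sup {i : A & child_idx (f i)} (fun p => child (f (projT1 p)) (projT2 p))
        (fun p => s_and (e (projT1 p)) (memV (child (f (projT1 p)) (projT2 p)) (f (projT1 p))))
  end.

Lemma memV_child u y t : memV u y t -> exists c, eqV u (child y c) t.
Proof. destruct y as [A f e]. intros [c [_ H]]. exists c. exact H. Qed.

Lemma memV_unionV u x t : memV u (unionV x) t <-> exists y, memV y x t /\ memV u y t.
Proof.
  destruct x as [A f e]. split.
  - intros [[i c] [[H1 H2] H3]]. simpl in *. exists (f i). split; [apply memV_sup, H1|].
    eapply memV_eq_l; [apply eqV_sym, H3 | exact H2].
  - intros [y [[i [H1 H2]] H3]]. apply (memV_eq_r _ _ _ _ H2) in H3.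
    destruct (memV_child _ _ _ H3) as [c Hc].
    exists (existT _ i c). split; [split|]; simpl; trivial.
    eapply memV_eq_l; eassumption.
Qed.

Lemma Union_valid r t : ev (sentence Union) r t.
Proof.
  simpl. apply box_all. clear t. intros t x. exists (unionV x). apply box_all. clear t.
  intros t z.
  refine (s_iff_all (memV _ _) (s_ex (fun u => s_and (memV u x) (memV z u))) t _).
  intros s. apply memV_unionV.
Qed.

Lemma Infinity_valid r t : ev (sentence Infinity) r t.
Proof. exists omegaV. exact (Inductive_set_omegaV t). Qed.

(** A subset of [x] is determined by the truth values with which it contains the children
    of [x]. *)
Definition powerV x : V X :=
  match x with
  | sup A f e => famV (fun w : A -> Open X => sup A f (fun i => s_and (e i) (w i)))
  end.

Lemma memV_powerV z x t : memV z (powerV x) t <-> Sem.Sub z x t.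
Proof.
  rewrite Sub_spec. destruct x as [A f e]. simpl powerV. rewrite memV_famV. split.
  - intros [w Hw]. keep Hw. apply box_all. clear t Hw. intros t Hw u Hu.
    apply (memV_eq_r _ _ _ _ Hw) in Hu. destruct Hu as [i [[Hi _] E]]. exists i. split; assumption.
  - intros H. exists (fun i => memV (f i) z). apply eqV_ext. keep H. apply box_all.
    clear t H. intros t H u. apply box_incl in H. split.
    + intros Hu. destruct (H u Hu) as [i [Hi E]]. exists i. split; [split|]; trivial.
      eapply memV_eq_l; eassumption.
    + intros [i [[Hi Hz] E]]. eapply memV_eq_l; [apply eqV_sym, E | exact Hz].
Qed.

Lemma PowerSet_valid r t : ev (sentence PowerSet) r t.
Proof.
  simpl. apply box_all. clear t. intros t x. exists (powerV x). apply box_all. clear t.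
  intros t z.
  refine (s_iff_all (memV _ _) (Sem.Sub z x) t _). intros s. apply memV_powerV.
Qed.

Definition valid r (w : list (V X)) (P : pform) : Prop :=
  forall t, ev (P (length w)) (env r w) t.

Lemma valid_tr r w P phi : tr_form r w P phi -> (forall t, phi t) -> valid r w P.
Proof. intros <- H. exact H. Qed.

Lemma valid_all r w (F : level -> pform) :
  (forall v, valid r (v :: w) (F (length w))) -> valid r w (p_all F).
Proof. intros H t. apply box_all. intros s x. apply H. Qed.

Lemma valid_alls r n w (F : list level -> pform) :
  (forall w' l vs, length l = n -> length vs = n -> Forall2 (denotes_level r w') l vs ->
     extends w w' -> valid r w' (F l)) ->
  valid r w (p_alls n F).
Proof.
  revert w F. induction n as [|n IH]; intros w F H.
  - apply (H w [] []); auto using extends_refl.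
  - apply valid_all. intros v. apply IH. intros w' l vs Hl Hvs D E.
    apply (H w' (length w :: l) (v :: vs)); simpl; auto.
    + constructor; [|assumption].
      eapply denotes_level_mono; [exact E | apply denotes_level_new].
    + eapply extends_trans; [|exact E]. exists [v]. reflexivity.
Qed.

Lemma Forall2_nth r w l vs i :
  Forall2 (denotes_level r w) l vs -> i < length l ->
  env r w (length w - S (nth i l 0)) = lenv vs i.
Proof.
  intros H. revert i. induction H as [|x v l vs [_ Hx] _ IH]; intros i Hi; simpl in Hi; [lia|].
  destruct i as [|i]; [exact Hx | apply IH; lia].
Qed.

Lemma map_nth_seq {A : Type} (l : list A) (d : A) :
  map (fun i => nth i l d) (seq 0 (length l)) = l.
Proof.
  induction l as [|a l IH]; [reflexivity|]. simpl. f_equal.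
  rewrite <- seq_shift, map_map. exact IH.
Qed.

Lemma Forall2_mono r w w' l vs :
  extends w w' -> Forall2 (denotes_level r w) l vs -> Forall2 (denotes_level r w') l vs.
Proof. intros E H. induction H; constructor; eauto using denotes_level_mono. Qed.

Lemma tr_inst r w phi l vs :
  Forall2 (denotes_level r w) l vs -> free_below (S (length l)) phi ->
  tr_fun r w (fun k => inst phi (k :: l)) (fun v => ev phi (lenv (v :: vs))).
Proof.
  intros D Hf w' E x v Dx. unfold tr_form, inst. rewrite ev_rename.
  apply (ev_free phi (S (length l))); [assumption|]. intros i Hi.
  eapply Forall2_nth; [|exact Hi].
  constructor; [assumption | eapply Forall2_mono; eassumption].
Qed.

Lemma tr_inst_rel r w phi Z vZ l vs :
  denotes_level r w Z vZ -> Forall2 (denotes_level r w) l vs ->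
  free_below (S (length l)) phi ->
  tr_fun r w (fun k => inst_rel Z phi (k :: l)) (fun v => ev_rel vZ phi (lenv (v :: vs))).
Proof.
  intros DZ D Hf w' E x v Dx. apply (denotes_level_mono _ _ _ _ _ E) in DZ.
  destruct DZ as [_ <-]. unfold tr_form, inst_rel, inst.
  rewrite ev_relativize. apply (ev_rel_free _ phi (S (length l))); [assumption|]. intros i Hi.
  eapply Forall2_nth; [|exact Hi].
  constructor; [assumption | eapply Forall2_mono; eassumption].
Qed.

Fixpoint all_mem (vs : list (V X)) W : Open X :=
  match vs with
  | [] => s_imp s_false s_false
  | v :: vs => s_and (memV v W) (all_mem vs W)
  end.

Lemma tr_all_mem r w l vs Z vZ :
  Forall2 (denotes_level r w) l vs -> denotes_level r w Z vZ ->
  tr_form r w (p_all_mem l Z) (all_mem vs vZ).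
Proof.
  intros H D. induction H; simpl; eauto 10 with translate.
Qed.

Lemma Separation_valid n phi r t :
  free_below (S n) phi -> ev (sentence (Separation n phi)) r t.
Proof.
  intros Hf. revert t. change (valid r [] (Separation n phi)). apply valid_alls.
  intros w l vs Hl Hvs D _. subst n.
  assert (HT : forall F G, tr_fun r w F G ->
    tr_form r w (∀ a, ∃ b, ∀ k, k ∈ b ⇔ (k ∈ a ∧ F k))%set
      (s_all (fun a => s_ex (fun b => s_all (fun x =>
        s_iff (Sem.t_mem (SVar x) (SVar b)) (s_and (Sem.t_mem (SVar x) (SVar a)) (G x)))))))
    by (intros; eauto 20 with translate).
  eapply valid_tr; [apply HT, tr_inst; eassumption|]. clear HT.
  intros t. apply box_all. clear t. intros t [A f e].
  exists (sup A f (fun i => s_and (e i) (ev phi (lenv (f i :: vs))))).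
  apply box_all. clear t. intros t x.
  apply s_iff_all. intros s. split.
  - intros [i [[Hi Hp] E]]. split; [exists i; split; assumption|].
    rewrite lenv_cons in *. eapply ev_congr1; [apply eqV_sym|]; eassumption.
  - intros [[i [Hi E]] Hp]. exists i. split; [split|]; trivial.
    rewrite lenv_cons in *. eapply ev_congr1; eassumption.
Qed.

Lemma SetInduction_valid n phi r t :
  free_below (S n) phi -> ev (sentence (SetInduction n phi)) r t.
Proof.
  intros Hf. revert t. change (valid r [] (SetInduction n phi)). apply valid_alls.
  intros w l vs Hl Hvs D _. subst n.
  assert (HT : forall F G, tr_fun r w F G ->
    tr_form r w ((∀ k, (∀[k] m, F m) ⇒ F k) ⇒ ∀ k, F k)%set
      (s_imp (s_all (fun x => s_imp (Sem.all_in (SVar x) G) (G x))) (s_all G)))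
    by (intros; eauto 20 with translate).
  eapply valid_tr; [apply HT, tr_inst; eassumption|]. clear HT.
  intros t. apply box_all. clear t. intros t H.
  assert (Hx : forall x s, s_all (fun x => s_imp
    (Sem.all_in (SVar x) (fun v => ev phi (lenv (v :: vs)))) (ev phi (lenv (x :: vs)))) s ->
    ev phi (lenv (x :: vs)) s).
  { clear t H. induction x as [A f IH e]. intros t H. assert (H' := box_incl _ _ H).
    apply (box_incl _ _ (H' (sup A f e))).
    apply (all_in_den _ (sup A f e)); [apply den_refl|].
    simpl in H. keep H. apply box_all. clear t H H'. intros t H y [i [_ E]].
    rewrite lenv_cons. eapply ev_congr1; [apply eqV_sym, E|]. rewrite <- lenv_cons. apply IH.
    exact H. }
  keep H. apply box_all. eauto.
Qed.

Lemma Reflection_valid n phi r t :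
  free_below (S n) phi -> ev (sentence (Reflection n phi)) r t.
Proof.
  intros Hf. revert t. change (valid r [] (Reflection n phi)). apply valid_alls.
  intros w l vs Hl Hvs D _. subst n. apply valid_all. intros z.
  assert (Ez : extends w (z :: w)) by (exists [z]; reflexivity).
  assert (Dz := denotes_level_new r w z). set (lz := length w : level) in *. change (length w) with lz in Dz. clearbody lz.
  apply (Forall2_mono _ _ _ _ _ Ez) in D. set (w1 := z :: w) in *. clearbody w1. clear Ez w.
  set (base := {| idx := nat; elt := lenv (z :: vs) |}).
  set (Z := famV (hull base)).
  intros t. exists Z. revert t. change (valid r (Z :: w1) (
    (Transitive (length w1) ∧ lz ∈ (length w1 : level) ∧ p_all_mem l (length w1) ∧
    ∀[length w1 : level] k, inst phi (k :: l) ⇔ inst_rel (length w1) phi (k :: l)))%set).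
  assert (EZ : extends w1 (Z :: w1)) by (exists [Z]; reflexivity).
  assert (DZ := denotes_level_new r w1 Z). set (lZ := length w1 : level) in *. change (length w1) with lZ in DZ. clearbody lZ.
  apply (Forall2_mono _ _ _ _ _ EZ) in D. apply (denotes_level_mono _ _ _ _ _ EZ) in Dz.
  set (w := Z :: w1) in *. clearbody w.
  assert (HT : forall F G F' G' P p, tr_fun r w F G -> tr_fun r w F' G' -> tr_form r w P p ->
    tr_form r w (Transitive lZ ∧ lz ∈ lZ ∧ P ∧ ∀[lZ] k, F k ⇔ F' k)%set
      (s_and (Sem.Transitive Z) (s_and (Sem.t_mem (SVar z) (SVar Z)) (s_and p
        (Sem.all_in (SVar Z) (fun x => s_iff (G x) (G' x)))))))
    by (intros; eauto 20 with translate).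
  eapply valid_tr.
  { apply HT; [apply tr_inst | apply tr_inst_rel | apply tr_all_mem]; eassumption. }
  clear HT.
  assert (Hbase : forall i t, memV (lenv (z :: vs) i) Z t) by (intros i t; apply (hull_base base i)).
  assert (Hvs' : forall t vs', (forall i, i < length vs' -> exists j, nth i vs' emptyV = lenv (z :: vs) j) ->
    all_mem vs' Z t).
  { intros t vs'. induction vs' as [|v vs' IH]; intros H; simpl.
    - apply box_all. trivial.
    - split.
      + destruct (H 0) as [j Hj]; [simpl; lia|]. simpl in Hj. rewrite Hj. apply Hbase.
      + apply IH. intros i Hi. apply (H (S i)). simpl. lia. }
  intros t. split; [apply hull_transitive | split; [apply (Hbase 0) | split]].
  - apply Hvs'. intros i _. exists (S i). reflexivity.
  - apply (all_in_den _ Z); [apply den_refl|]. apply box_all. clear t. intros t x Hx.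
    apply memV_famV in Hx. destruct Hx as [i Hi]. apply s_iff_spec.
    keep Hi. apply box_all. clear t Hi. intros t Hi.
    assert (Hl' : exists l', map (hull base) l' = vs).
    { exists (map (fun j => existT (fun n => idx (stage base n)) 0 (S j)) (seq 0 (length vs))).
      rewrite map_map. apply (map_nth_seq vs emptyV). }
    destruct Hl' as [l' Hl'].
    assert (R := witnessing_reflects _ (hull_witnessing base) phi (i :: l') t).
    rewrite map_cons, Hl', lenv_cons in R. rewrite lenv_cons.
    split; intros H.
    + apply (ev_rel_congr1 _ _ _ _ _ _ (eqV_sym _ _ _ Hi)), R.
      eapply ev_congr1; eassumption.
    + apply (ev_congr1 _ _ _ _ _ (eqV_sym _ _ _ Hi)), R.
      eapply ev_rel_congr1; eassumption.
Qed.
Lemma IZF_Ref_valid a r t : IZF_Ref a -> ev a r t.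
Proof.
  intros [? [] | n phi Hf | n phi Hf].
  - apply Extensionality_valid.
  - apply EmptySet_valid.
  - apply Pairing_valid.
  - apply Union_valid.
  - apply Infinity_valid.
  - apply PowerSet_valid.
  - apply Separation_valid; assumption.
  - apply SetInduction_valid; assumption.
  - apply Reflection_valid; assumption.
Qed.

End Validity.

(** * Functions and arithmetic in the model *)

Section Functions.
Context {X : Space}.
Implicit Types (x y z u v f A B : V X) (s t : pt) (a b c : sterm X).

Definition is_function f A B : Open X := interior (fun s =>
  (forall p, memV p f s -> exists x y, memV x A s /\ memV y B s /\ eqV p (opairV x y) s) /\
  (forall x, memV x A s -> exists y, memV y B s /\ memV (opairV x y) f s) /\
  (forall x y z, memV (opairV x y) f s -> memV (opairV x z) f s -> eqV y z s)).

Lemma memV_opairV_congr x y x' y' f t :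
  eqV x x' t -> eqV y y' t -> memV (opairV x y) f t -> memV (opairV x' y') f t.
Proof. intros Hx Hy. apply memV_eq_l, opairV_eq. auto. Qed.

Lemma t_mem_OPair_var x y f t :
  Sem.t_mem (Sem.OPair (SVar x) (SVar y)) (SVar f) t <-> memV (opairV x y) f t.
Proof. apply t_mem_den; [apply den_OPair|]; apply den_refl. Qed.

Lemma Function_spec f a b A B t :
  den a A t -> den b B t -> (Sem.Function f a b t <-> is_function f A B t).
Proof.
  intros Ha Hb. unfold Sem.Function.
  apply (s_bind_den _ _ A); [assumption|]. intros A' EA.
  apply (s_bind_den _ _ B); [assumption|]. intros B' EB.
  clear a b Ha Hb.
  assert (Hrange : forall s p, eqV A' A s -> eqV B' B s ->
    (Sem.ex_in (SVar A') (fun x => Sem.ex_in (SVar B') (fun y =>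
       Sem.t_eq (SVar p) (Sem.OPair (SVar x) (SVar y)))) s <->
     exists x y, memV x A s /\ memV y B s /\ eqV p (opairV x y) s)).
  { intros s p HA HB.
    assert (HE : forall x y, Sem.t_eq (SVar p) (Sem.OPair (SVar x) (SVar y)) s <->
      eqV p (opairV x y) s).
    { intros x y. apply t_eq_den; [|apply den_OPair]; apply den_refl. }
    rewrite (ex_in_den _ A) by (apply den_var, HA). split.
    - intros [x [Hx H]]. apply (ex_in_den _ B) in H; [|apply den_var, HB].
      destruct H as [y [Hy H]]. apply HE in H. eauto.
    - intros [x [y [Hx [Hy H]]]]. exists x. split; [assumption|].
      apply (ex_in_den _ B); [apply den_var, HB|]. exists y. rewrite HE. auto. }
  change ((Sem.all_in (SVar f) (fun p => Sem.ex_in (SVar A') (fun x =>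
      Sem.ex_in (SVar B') (fun y => Sem.t_eq (SVar p) (Sem.OPair (SVar x) (SVar y))))) t /\
    Sem.all_in (SVar A') (fun x => s_ex (fun y => s_and
      (Sem.t_mem (Sem.OPair (SVar x) (SVar y)) (SVar f))
      (s_all (fun z => s_imp (Sem.t_mem (Sem.OPair (SVar x) (SVar z)) (SVar f))
         (eqV z y))))) t) <-> is_function f A B t).
  rewrite (all_in_den _ f) by apply den_refl.
  rewrite (all_in_den _ A) by (apply den_var; assumption).
  split.
  - intros [H1 H2]. keep EA. keep EB. keep H1. keep H2. apply box_all.
    clear t EA EB H1 H2. intros s H2 H1 EB EA. apply box_incl in H1, H2.
    assert (R : forall p, memV p f s ->
      exists x y, memV x A s /\ memV y B s /\ eqV p (opairV x y) s).
    { intros p Hp. apply Hrange; auto. }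
    assert (T : forall x, memV x A s -> exists y, memV (opairV x y) f s /\
      forall z, memV (opairV x z) f s -> eqV z y s).
    { intros x Hx. destruct (H2 x Hx) as [y [Hy U]]. exists y.
      split; [apply t_mem_OPair_var, Hy|]. intros z Hz. apply box_incl in U.
      specialize (U z). apply box_incl in U. apply U, t_mem_OPair_var, Hz. }
    split; [exact R | split].
    + intros x Hx. destruct (T x Hx) as [y [Hy _]]. exists y. split; [|assumption].
      destruct (R _ Hy) as [x' [y' [_ [Hy' E]]]]. apply opairV_eq in E.
      eapply memV_eq_l; [apply eqV_sym, E | exact Hy'].
    + intros x y z Hy Hz. destruct (R _ Hy) as [x' [y' [Hx' [_ E]]]].
      apply opairV_eq in E. destruct E as [E _].
      destruct (T x') as [y0 [_ U]]; [assumption|].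
      apply eqV_trans with y0; [|apply eqV_sym]; apply U;
        (eapply memV_opairV_congr; [exact E | apply eqV_refl | assumption]).
  - intros H. split.
    + keep EA. keep EB. keep H. apply box_all. clear t EA EB H. intros s H EB EA p Hp.
      apply box_incl in H. apply Hrange; auto. apply H, Hp.
    + keep H. apply box_all. clear t EA EB H. intros s H x Hx.
      assert (H' := box_incl _ _ H). destruct H' as [_ [T U]].
      destruct (T x Hx) as [y [_ Hy]]. exists y.
      split; [apply t_mem_OPair_var, Hy|].
      simpl. keep H. keep Hy. apply box_all. clear s H Hx T U Hy. intros s Hy H z.
      keep H. keep Hy. apply box_all. clear s H Hy. intros s Hy H Hz.
      apply box_incl in H. destruct H as [_ [_ U]].
      apply (U x); [apply t_mem_OPair_var|]; assumption.
Qed.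

Lemma den_App f a b x y A B t :
  is_function f A B t -> memV (opairV x y) f t -> den a f t -> den b x t ->
  den (Sem.App a b) y t.
Proof.
  intros Hf Hxy Ha Hb. apply den_the. keep Hf. keep Hxy. keep Ha. keep Hb.
  apply box_all. clear t Hf Hxy Ha Hb. intros s Hb Ha Hxy Hf z.
  rewrite (t_mem_den _ _ (opairV x z) f) by (trivial; apply den_OPair; trivial; apply den_refl).
  apply box_incl in Hf. destruct Hf as [_ [_ U]]. split.
  - intros H. apply (U x); assumption.
  - intros H. eapply memV_opairV_congr; [apply eqV_refl | apply eqV_sym, H | assumption].
Qed.

Lemma is_function_total f A B x t :
  is_function f A B t -> memV x A t -> exists y, memV y B t /\ memV (opairV x y) f t.
Proof. intros H. apply box_incl in H. apply H. Qed.

Lemma is_function_unique f A B x y z t :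
  is_function f A B t -> memV (opairV x y) f t -> memV (opairV x z) f t -> eqV y z t.
Proof. intros H. apply box_incl in H. apply H. Qed.

Lemma is_function_ext f g A B t :
  is_function f A B t -> is_function g A B t ->
  box (fun s => forall x, memV x A s ->
    exists y, memV (opairV x y) f s /\ memV (opairV x y) g s) t -> eqV f g t.
Proof.
  intros Hf Hg H. apply eqV_ext. keep Hf. keep Hg. keep H. apply box_all.
  clear t Hf Hg H. intros s H Hg Hf p. apply box_incl in H, Hf, Hg.
  destruct Hf as [Rf [_ Uf]], Hg as [Rg [_ Ug]].
  split; intros Hp.
  - destruct (Rf p Hp) as [x [y [Hx [_ E]]]]. destruct (H x Hx) as [y' [H1 H2]].
    eapply memV_eq_l; [apply eqV_sym, E|]. apply (memV_eq_l _ _ _ _ E) in Hp.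
    eapply memV_opairV_congr; [apply eqV_refl | apply (Uf x y' y) | ]; assumption.
  - destruct (Rg p Hp) as [x [y [Hx [_ E]]]]. destruct (H x Hx) as [y' [H1 H2]].
    eapply memV_eq_l; [apply eqV_sym, E|]. apply (memV_eq_l _ _ _ _ E) in Hp.
    eapply memV_opairV_congr; [apply eqV_refl | apply (Ug x y' y) | ]; assumption.
Qed.

Lemma is_function_congr f g A B t :
  eqV f g t -> is_function f A B t -> is_function g A B t.
Proof.
  intros E H. keep E. keep H. apply box_all. clear t E H. intros s H E.
  apply box_incl in H. destruct H as [R [T U]].
  assert (E' : forall p, memV p g s -> memV p f s).
  { intros p. apply memV_eq_r, eqV_sym, E. }
  split; [|split].
  - auto.
  - intros x Hx. destruct (T x Hx) as [y [Hy H]]. exists y.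
    split; [assumption | eapply memV_eq_r; eassumption].
  - intros x y z Hy Hz. apply (U x); auto.
Qed.

Definition relV {I : Type} (g h : I -> V X) (e : I -> Open X) : V X :=
  sup I (fun i => opairV (g i) (h i)) e.

Lemma memV_relV {I : Type} (g h : I -> V X) (e : I -> Open X) x y t :
  memV (opairV x y) (relV g h e) t <-> exists i, e i t /\ eqV x (g i) t /\ eqV y (h i) t.
Proof.
  split.
  - intros [i [Hi E]]. apply opairV_eq in E. eauto.
  - intros [i [Hi E]]. exists i. split; [assumption|]. apply opairV_eq, E.
Qed.

Lemma is_function_relV {I : Type} (g h : I -> V X) (e : I -> Open X) A B t :
  box (fun s =>
    (forall i, e i s -> memV (g i) A s /\ memV (h i) B s) /\
    (forall x, memV x A s -> exists i, e i s /\ eqV x (g i) s) /\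
    (forall i j, e i s -> e j s -> eqV (g i) (g j) s -> eqV (h i) (h j) s)) t ->
  is_function (relV g h e) A B t.
Proof.
  apply box_mono. intros s [H1 [H2 H3]]. split; [|split].
  - intros p [i [Hi E]]. exists (g i), (h i). split; [apply H1, Hi | split; [apply H1, Hi | exact E]].
  - intros x Hx. destruct (H2 x Hx) as [i [Hi E]]. exists (h i).
    split; [apply H1, Hi|]. apply memV_relV. exists i.
    split; [assumption | split; [assumption | apply eqV_refl]].
  - intros x y z Hy Hz. apply memV_relV in Hy, Hz.
    destruct Hy as [i [Hi [Ei Ey]]], Hz as [j [Hj [Ej Ez]]].
    assert (E : eqV (g i) (g j) s) by eauto using eqV_trans, eqV_sym.
    specialize (H3 i j Hi Hj E). eauto using eqV_trans, eqV_sym.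
Qed.

Lemma all_in_Omega (F : V X -> Open X) t :
  Sem.all_in Sem.Omega F t <->
  box (fun s => forall n x, eqV x (nm n) s -> F x s) t.
Proof.
  rewrite (all_in_den _ omegaV) by apply den_Omega.
  split; apply box_mono; intros s H.
  - intros n x E. apply H, memV_famV. eauto.
  - intros x Hx. apply memV_famV in Hx. destruct Hx as [n E]. eauto.
Qed.

Lemma ex_in_Omega (F : V X -> Open X) t :
  Sem.ex_in Sem.Omega F t <-> exists n x, eqV x (nm n) t /\ F x t.
Proof.
  rewrite (ex_in_den _ omegaV) by apply den_Omega.
  split.
  - intros [x [Hx H]]. apply memV_famV in Hx. destruct Hx as [n E]. eauto.
  - intros [n [x [E H]]]. exists x. split; [apply memV_famV|]; eauto.
Qed.

Lemma memV_omegaV n t : memV (nm n) omegaV t.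
Proof. apply memV_famV. exists n. apply eqV_refl. Qed.

(** Definition by recursion; addition and multiplication are both of this form. *)
Lemma den_rec a c (H : sterm X -> sterm X) k n (h : nat -> nat) t :
  den a (nm k) t -> den c (nm n) t ->
  box (fun s => forall b m, den b (nm m) s -> den (H b) (nm (h m)) s) t ->
  den (SThe (fun z => s_ex (fun f => s_and (Sem.Function f Sem.Omega Sem.Omega) (s_and
    (Sem.t_eq (Sem.App (SVar f) Sem.Zero) a) (s_and
    (Sem.all_in Sem.Omega (fun m =>
      Sem.t_eq (Sem.App (SVar f) (Sem.Succ (SVar m))) (H (Sem.App (SVar f) (SVar m)))))
    (Sem.t_eq (Sem.App (SVar f) c) (SVar z)))))))
    (nm (Nat.iter n h k)) t.
Proof.
  intros Ha Hc HH. apply den_the. keep Ha. keep Hc. keep HH. apply box_all.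
  clear t Ha Hc HH. intros s HH Hc Ha z. split.
  - intros [f [Hf [H0 [HS Hz]]]].
    apply (Function_spec f _ _ omegaV omegaV) in Hf; [|apply den_Omega..].
    apply all_in_Omega, box_incl in HS. apply box_incl in HH.
    assert (Hm : forall m, memV (opairV (nm m) (nm (Nat.iter m h k))) f s).
    { induction m as [|m IH].
      - destruct (is_function_total _ _ _ (nm 0) s Hf) as [y [_ Hy]]; [apply memV_omegaV|].
        eapply memV_opairV_congr; [apply eqV_refl| |exact Hy].
        apply (t_eq_den _ _ y (nm k)) in H0; [exact H0| |exact Ha].
        eapply den_App; [exact Hf | exact Hy | apply den_refl | apply den_Zero].
      - destruct (is_function_total _ _ _ (nm (S m)) s Hf) as [y [_ Hy]]; [apply memV_omegaV|].
        eapply memV_opairV_congr; [apply eqV_refl| |exact Hy].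
        specialize (HS m (nm m) (eqV_refl _ _)).
        apply (t_eq_den _ _ y (nm (h (Nat.iter m h k)))) in HS; [exact HS| |].
        + eapply den_App; [exact Hf | exact Hy | apply den_refl | apply den_Succ, den_refl].
        + apply HH. eapply den_App; [exact Hf | exact IH | apply den_refl | apply den_refl]. }
    apply eqV_sym. apply (t_eq_den _ _ (nm (Nat.iter n h k)) z) in Hz; [exact Hz| |apply den_refl].
    eapply den_App; [exact Hf | apply Hm | apply den_refl | exact Hc].
  - intros E.
    set (f := relV nm (fun m => nm (Nat.iter m h k)) (fun _ => s_prop True)).
    assert (Hf : forall t, is_function f omegaV omegaV t).
    { intros t. apply is_function_relV, box_all. clear. intros s. split; [|split].
      - auto using memV_omegaV.
      - intros x Hx. apply memV_famV in Hx. destruct Hx as [m Hm]. exists m. split; [exact I | exact Hm].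
      - intros i j _ _ Eij. apply nm_eq in Eij. subst j. apply eqV_refl. }
    assert (Hm : forall m t, memV (opairV (nm m) (nm (Nat.iter m h k))) f t).
    { intros m t. apply memV_relV. exists m. split; [exact I | split; apply eqV_refl]. }
    exists f. split; [|split; [|split]].
    + apply (Function_spec f _ _ omegaV omegaV); auto using den_Omega.
    + apply (t_eq_den _ _ (nm k) (nm k)); [|exact Ha | apply eqV_refl].
      eapply den_App; [apply Hf | apply (Hm 0) | apply den_refl | apply den_Zero].
    + apply all_in_Omega. keep HH. apply box_all. clear s HH Hc Ha E. intros s HH m x Ex.
      apply box_incl in HH.
      apply (t_eq_den _ _ (nm (Nat.iter (S m) h k)) (nm (Nat.iter (S m) h k))); [| |apply eqV_refl].
      * eapply den_App; [apply Hf | apply (Hm (S m)) | apply den_refl|].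
        apply den_Succ, den_var, Ex.
      * apply HH. eapply den_App; [apply Hf | apply Hm | apply den_refl | apply den_var, Ex].
    + apply (t_eq_den _ _ (nm (Nat.iter n h k)) z); [|apply den_refl | apply eqV_sym, E].
      eapply den_App; [apply Hf | apply Hm | apply den_refl | exact Hc].
Qed.

Lemma den_Add a b m n t :
  den a (nm m) t -> den b (nm n) t -> den (Sem.Add a b) (nm (m + n)) t.
Proof.
  intros Ha Hb. replace (m + n) with (Nat.iter n S m).
  - apply den_rec; trivial. apply box_all. intros s c k. apply den_Succ.
  - clear. induction n; simpl; lia.
Qed.

Lemma den_Mul a b m n t :
  den a (nm m) t -> den b (nm n) t -> den (Sem.Mul a b) (nm (m * n)) t.
Proof.
  intros Ha Hb. replace (m * n) with (Nat.iter n (fun k => k + m) 0).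
  - apply (den_rec Sem.Zero b (fun d => Sem.Add d a)); [apply den_Zero | exact Hb |].
    keep Ha. apply box_all. clear t Ha Hb. intros s Ha c k Hc. apply den_Add; assumption.
  - clear. induction n; simpl; lia.
Qed.

End Functions.

Open Scope Q_scope.

(** * Rational numbers in the model *)

Section FractionArithmetic.

Definition toQ (a b c : nat) : Q := (Z.of_nat a - Z.of_nat b) # Pos.of_nat c.

Lemma pos_of_nat c : (0 < c)%nat -> Z.pos (Pos.of_nat c) = Z.of_nat c.
Proof. intros H. rewrite <- positive_nat_Z, Nat2Pos.id by lia. reflexivity. Qed.

Lemma toQ_eq a b c a' b' c' : (0 < c)%nat -> (0 < c')%nat ->
  (toQ a b c == toQ a' b' c' <-> (a * c' + b' * c = a' * c + b * c')%nat).
Proof.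
  intros Hc Hc'. unfold toQ, Qeq. cbn [Qnum Qden]. rewrite !pos_of_nat by lia. nia.
Qed.

Lemma toQ_lt a b c a' b' c' : (0 < c)%nat -> (0 < c')%nat ->
  (toQ a b c < toQ a' b' c' <-> (a * c' + b' * c < a' * c + b * c')%nat).
Proof.
  intros Hc Hc'. unfold toQ, Qlt. cbn [Qnum Qden]. rewrite !pos_of_nat by lia. nia.
Qed.

Lemma toQ_add a b c a' b' c' : (0 < c)%nat -> (0 < c')%nat ->
  toQ (a * c' + a' * c) (b * c' + b' * c) (c * c') == toQ a b c + toQ a' b' c'.
Proof.
  intros Hc Hc'. unfold toQ, Qplus, Qeq. cbn [Qnum Qden].
  rewrite Pos2Z.inj_mul, !pos_of_nat by nia.
  rewrite !Nat2Z.inj_add, !Nat2Z.inj_mul. ring.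
Qed.

Lemma toQ_opp a b c : toQ b a c == - toQ a b c.
Proof. unfold toQ, Qopp, Qeq. cbn [Qnum Qden]. ring. Qed.

Lemma toQ_surjective q : exists a b c, (0 < c)%nat /\ toQ a b c == q.
Proof.
  destruct q as [n d]. exists (Z.to_nat n), (Z.to_nat (- n)), (Pos.to_nat d).
  split; [apply Pos2Nat.is_pos|]. unfold toQ. rewrite Pos2Nat.id. unfold Qeq.
  cbn [Qnum Qden]. f_equal. lia.
Qed.
End FractionArithmetic.

Section Rationals.
Context {X : Space}.
Implicit Types (x y z u v f A B : V X) (s t : pt) (a b c : sterm X) (p q : Q).

Definition tripleV (m n k : nat) : V X := opairV (opairV (nm m) (nm n)) (nm k).

Lemma tripleV_eq m n k m' n' k' t :
  eqV (tripleV m n k) (tripleV m' n' k') t <-> m = m' /\ n = n' /\ k = k'.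
Proof. unfold tripleV. rewrite !opairV_eq, !nm_eq. tauto. Qed.

(** The class of all fractions with the value [q]; it depends on [q] only up to [==]. *)
Definition ratV q : V X :=
  sup (nat * nat * nat) (fun i => let '(m, n, k) := i in tripleV m n k)
    (fun i => let '(m, n, k) := i in s_prop ((0 < k)%nat /\ toQ m n k == q)).

Lemma memV_ratV u q t :
  memV u (ratV q) t <-> exists m n k, (0 < k)%nat /\ toQ m n k == q /\ eqV u (tripleV m n k) t.
Proof.
  split.
  - intros [[[m n] k] [[Hk Hq] E]]. exists m, n, k. auto.
  - intros [m [n [k [Hk [Hq E]]]]]. exists (m, n, k). split; [split|]; assumption.
Qed.

Lemma ratV_eq p q t : eqV (ratV p) (ratV q) t <-> p == q.
Proof.
  split; intros H.
  - destruct (toQ_surjective p) as [m [n [k [Hk Hp]]]].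
    assert (M : memV (tripleV m n k) (ratV q) t).
    { eapply memV_eq_r; [exact H|]. apply memV_ratV. exists m, n, k.
      split; [|split]; trivial. apply eqV_refl. }
    apply memV_ratV in M. destruct M as [m' [n' [k' [_ [Hq E]]]]].
    apply tripleV_eq in E. destruct E as [-> [-> ->]]. rewrite <- Hp, <- Hq. reflexivity.
  - apply eqV_ext, box_all. clear t. intros t u. rewrite !memV_ratV.
    split; intros [m [n [k [Hk [Hq E]]]]]; exists m, n, k; (split; [|split]); trivial;
      rewrite Hq; [|symmetry]; exact H.
Qed.

Lemma den_ratV_eq a p q t : den a (ratV p) t -> p == q -> den a (ratV q) t.
Proof. intros H E. eapply den_eq; [exact H | apply ratV_eq, E]. Qed.

Lemma ex_in_Omega3 (F : V X -> V X -> V X -> Open X) t :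
  Sem.ex_in Sem.Omega (fun x => Sem.ex_in Sem.Omega (fun y => Sem.ex_in Sem.Omega (F x y))) t <->
  exists m n k x y z, den (SVar x) (nm m) t /\ den (SVar y) (nm n) t /\ den (SVar z) (nm k) t /\
    F x y z t.
Proof.
  split.
  - intros H. apply ex_in_Omega in H. destruct H as [m [x [Ex H]]].
    apply ex_in_Omega in H. destruct H as [n [y [Ey H]]].
    apply ex_in_Omega in H. destruct H as [k [z [Ez H]]].
    exists m, n, k, x, y, z. auto using den_var.
  - intros [m [n [k [x [y [z [Ex [Ey [Ez H]]]]]]]]].
    apply ex_in_Omega. exists m, x. split; [apply den_var_inv, Ex|].
    apply ex_in_Omega. exists n, y. split; [apply den_var_inv, Ey|].
    apply ex_in_Omega. exists k, z. split; [apply den_var_inv, Ez | exact H].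
Qed.

Lemma Zero_lt c k t : den c (nm k) t -> (Sem.t_mem Sem.Zero c t <-> (0 < k)%nat).
Proof.
  intros H. rewrite (t_mem_den _ _ (nm 0) (nm k)) by (apply den_Zero || exact H).
  apply nm_mem.
Qed.

Lemma den_Frac a b c m n k t :
  den a (nm m) t -> den b (nm n) t -> den c (nm k) t -> (0 < k)%nat ->
  den (Sem.Frac a b c) (ratV (toQ m n k)) t.
Proof.
  intros Ha Hb Hc Hk. apply den_the. keep Ha. keep Hb. keep Hc. apply box_all.
  clear t Ha Hb Hc. intros t Hc Hb Ha q.
  apply (s_bind_den _ _ (nm m)); [assumption|]. intros x Ex.
  apply (s_bind_den _ _ (nm n)); [assumption|]. intros y Ey.
  apply (s_bind_den _ _ (nm k)); [assumption|]. intros z Ez.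
  apply described_by_elements. keep Ex. keep Ey. keep Ez. apply box_all.
  clear t Ha Hb Hc Ex Ey Ez. intros t Ez Ey Ex u. apply den_var in Ex, Ey, Ez.
  rewrite memV_ratV, ex_in_Omega3. split.
  - intros [m' [n' [k' [x' [y' [z' [Ex' [Ey' [Ez' [Hk' [Hu H]]]]]]]]]]].
    apply (Zero_lt _ k') in Hk'; [|assumption]. exists m', n', k'.
    split; [assumption|]. split.
    + apply toQ_eq; trivial.
      apply (t_eq_den _ _ (nm (m * k' + n' * k)) (nm (m' * k + n * k'))) in H;
        [|auto using den_Add, den_Mul..].
      apply nm_eq in H. lia.
    + apply (t_eq_den _ _ u (tripleV m' n' k')) in Hu;
        [assumption | apply den_refl | unfold tripleV; auto using den_OPair].
  - intros [m' [n' [k' [Hk' [Hq Hu]]]]]. apply toQ_eq in Hq; trivial.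
    exists m', n', k', (nm m'), (nm n'), (nm k').
    split; [apply den_refl|]. split; [apply den_refl|]. split; [apply den_refl|].
    split; [apply (Zero_lt _ k'); [apply den_refl | assumption]|]. split.
    + apply (t_eq_den _ _ u (tripleV m' n' k')); [apply den_refl | | assumption].
      unfold tripleV; auto using den_OPair, den_refl.
    + apply (t_eq_den _ _ (nm (m * k' + n' * k)) (nm (m' * k + n * k')));
        [auto using den_Add, den_Mul, den_refl..|].
      apply nm_eq. lia.
Qed.

Lemma eq_Frac a p x y z m n k t : den a (ratV p) t ->
  den (SVar x) (nm m) t -> den (SVar y) (nm n) t -> den (SVar z) (nm k) t -> (0 < k)%nat ->
  (Sem.t_eq a (Sem.Frac (SVar x) (SVar y) (SVar z)) t <-> p == toQ m n k).
Proof.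
  intros Ha Hx Hy Hz Hk.
  rewrite (t_eq_den _ _ (ratV p) (ratV (toQ m n k))) by auto using den_Frac.
  apply ratV_eq.
Qed.

Definition rationalsV : V X := famV ratV.

Lemma memV_rationalsV q t : memV (ratV q) rationalsV t.
Proof. apply memV_famV. exists q. apply eqV_refl. Qed.

Lemma den_Rationals t : den Sem.Rationals rationalsV t.
Proof.
  apply den_by_elements, box_all. clear t. intros t u.
  rewrite ex_in_Omega3. unfold rationalsV. rewrite memV_famV. split.
  - intros [m [n [k [x [y [z [Ex [Ey [Ez [Hk H]]]]]]]]]].
    apply (Zero_lt _ k) in Hk; [|assumption]. exists (toQ m n k).
    apply (t_eq_den _ _ u (ratV (toQ m n k))) in H; auto using den_refl, den_Frac.
  - intros [q Hq]. destruct (toQ_surjective q) as [m [n [k [Hk Eq]]]].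
    exists m, n, k, (nm m), (nm n), (nm k).
    split; [apply den_refl|]. split; [apply den_refl|]. split; [apply den_refl|].
    split; [apply (Zero_lt _ k); [apply den_refl | assumption]|].
    apply (eq_Frac _ q _ _ _ m n k); auto using den_refl, den_var.
    symmetry; assumption.
Qed.

Lemma RLt_spec a b p q t :
  den a (ratV p) t -> den b (ratV q) t -> (Sem.RLt a b t <-> p < q).
Proof.
  intros Ha Hb. unfold Sem.RLt. rewrite ex_in_Omega3. split.
  - intros [m [n [k [x [y [z [Ex [Ey [Ez H]]]]]]]]]. apply ex_in_Omega3 in H.
    destruct H as [m' [n' [k' [x' [y' [z' [Ex' [Ey' [Ez' [Hk [Hk' [H1 [H2 H]]]]]]]]]]]]].
    apply (Zero_lt _ k) in Hk; [|assumption]. apply (Zero_lt _ k') in Hk'; [|assumption].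
    apply (eq_Frac _ p _ _ _ m n k) in H1; trivial.
    apply (eq_Frac _ q _ _ _ m' n' k') in H2; trivial.
    rewrite H1, H2. apply toQ_lt; trivial.
    apply (t_mem_den _ _ (nm (m * k' + n' * k)) (nm (m' * k + n * k'))) in H;
      [|auto using den_Add, den_Mul..].
    apply nm_mem in H. exact H.
  - intros H. destruct (toQ_surjective p) as [m [n [k [Hk Ep]]]].
    destruct (toQ_surjective q) as [m' [n' [k' [Hk' Eq]]]].
    rewrite <- Ep, <- Eq in H. apply toQ_lt in H; trivial.
    exists m, n, k, (nm m), (nm n), (nm k).
    split; [apply den_refl|]. split; [apply den_refl|]. split; [apply den_refl|].
    apply ex_in_Omega3. exists m', n', k', (nm m'), (nm n'), (nm k').
    split; [apply den_refl|]. split; [apply den_refl|]. split; [apply den_refl|].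
    split; [apply (Zero_lt _ k); [apply den_refl | assumption]|].
    split; [apply (Zero_lt _ k'); [apply den_refl | assumption]|].
    split; [apply (eq_Frac _ p _ _ _ m n k); auto using den_refl; symmetry; assumption|].
    split; [apply (eq_Frac _ q _ _ _ m' n' k'); auto using den_refl; symmetry; assumption|].
    apply (t_mem_den _ _ (nm (m * k' + n' * k)) (nm (m' * k + n * k')));
      [auto using den_Add, den_Mul, den_refl..|].
    apply nm_mem. exact H.
Qed.

Lemma den_RAdd a b p q t :
  den a (ratV p) t -> den b (ratV q) t -> den (Sem.RAdd a b) (ratV (p + q)) t.
Proof.
  intros Ha Hb. apply den_the. keep Ha. keep Hb. apply box_all. clear t Ha Hb.
  intros t Hb Ha u. rewrite ex_in_Omega3.
  assert (HF : forall m n k m' n' k' x y z x' y' z', (0 < k)%nat -> (0 < k')%nat ->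
    den (SVar x) (nm m) t -> den (SVar y) (nm n) t -> den (SVar z) (nm k) t ->
    den (SVar x') (nm m') t -> den (SVar y') (nm n') t -> den (SVar z') (nm k') t ->
    p == toQ m n k -> q == toQ m' n' k' ->
    (Sem.t_eq (SVar u) (Sem.Frac (Sem.Add (Sem.Mul (SVar x) (SVar z')) (Sem.Mul (SVar x') (SVar z)))
      (Sem.Add (Sem.Mul (SVar y) (SVar z')) (Sem.Mul (SVar y') (SVar z)))
      (Sem.Mul (SVar z) (SVar z'))) t <-> eqV u (ratV (p + q)) t)).
  { intros. apply t_eq_den; [apply den_refl|].
    apply (den_ratV_eq _ (toQ (m * k' + m' * k) (n * k' + n' * k) (k * k'))).
    - apply den_Frac; auto using den_Add, den_Mul. nia.
    - rewrite toQ_add by assumption. rewrite H7, H8. reflexivity. }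
  split.
  - intros [m [n [k [x [y [z [Ex [Ey [Ez H]]]]]]]]]. apply ex_in_Omega3 in H.
    destruct H as [m' [n' [k' [x' [y' [z' [Ex' [Ey' [Ez' [Hk [Hk' [H1 [H2 H]]]]]]]]]]]]].
    apply (Zero_lt _ k) in Hk; [|assumption]. apply (Zero_lt _ k') in Hk'; [|assumption].
    apply (eq_Frac _ p _ _ _ m n k) in H1; trivial.
    apply (eq_Frac _ q _ _ _ m' n' k') in H2; trivial.
    eapply (HF m n k m' n' k'); eassumption.
  - intros H. destruct (toQ_surjective p) as [m [n [k [Hk Ep]]]].
    destruct (toQ_surjective q) as [m' [n' [k' [Hk' Eq]]]].
    symmetry in Ep, Eq.
    exists m, n, k, (nm m), (nm n), (nm k).
    split; [apply den_refl|]. split; [apply den_refl|]. split; [apply den_refl|].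
    apply ex_in_Omega3. exists m', n', k', (nm m'), (nm n'), (nm k').
    split; [apply den_refl|]. split; [apply den_refl|]. split; [apply den_refl|].
    split; [apply (Zero_lt _ k); [apply den_refl | assumption]|].
    split; [apply (Zero_lt _ k'); [apply den_refl | assumption]|].
    split; [apply (eq_Frac _ p _ _ _ m n k); auto using den_refl|].
    split; [apply (eq_Frac _ q _ _ _ m' n' k'); auto using den_refl|].
    apply (HF m n k m' n' k'); auto using den_refl.
Qed.

Lemma den_ROpp a p t : den a (ratV p) t -> den (Sem.ROpp a) (ratV (- p)) t.
Proof.
  intros Ha. apply den_the. keep Ha. apply box_all. clear t Ha.
  intros t Ha u. rewrite ex_in_Omega3.
  assert (HF : forall m n k x y z, (0 < k)%nat ->
    den (SVar x) (nm m) t -> den (SVar y) (nm n) t -> den (SVar z) (nm k) t ->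
    p == toQ m n k ->
    (Sem.t_eq (SVar u) (Sem.Frac (SVar y) (SVar x) (SVar z)) t <-> eqV u (ratV (- p)) t)).
  { intros. apply t_eq_den; [apply den_refl|].
    apply (den_ratV_eq _ (toQ n m k)); [apply den_Frac; assumption|].
    rewrite toQ_opp, H3. reflexivity. }
  split.
  - intros [m [n [k [x [y [z [Ex [Ey [Ez [Hk [H1 H]]]]]]]]]]].
    apply (Zero_lt _ k) in Hk; [|assumption].
    apply (eq_Frac _ p _ _ _ m n k) in H1; trivial. eapply (HF m n k); eassumption.
  - intros H. destruct (toQ_surjective p) as [m [n [k [Hk Ep]]]]. symmetry in Ep.
    exists m, n, k, (nm m), (nm n), (nm k).
    split; [apply den_refl|]. split; [apply den_refl|]. split; [apply den_refl|].
    split; [apply (Zero_lt _ k); [apply den_refl | assumption]|].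
    split; [apply (eq_Frac _ p _ _ _ m n k); auto using den_refl|].
    apply (HF m n k); auto using den_refl.
Qed.

Lemma den_RSub a b p q t :
  den a (ratV p) t -> den b (ratV q) t -> den (Sem.RSub a b) (ratV (p - q)) t.
Proof. intros Ha Hb. apply den_RAdd; [|apply den_ROpp]; assumption. Qed.

Lemma den_RZero t : den Sem.RZero (ratV 0) t.
Proof.
  apply (den_ratV_eq _ (toQ 0 0 1)); [|reflexivity].
  apply den_Frac; [apply den_Zero | apply den_Zero | apply (den_Succ _ (nm 0)), den_Zero | lia].
Qed.

Lemma den_RInv a m t : (0 < m)%nat -> den a (nm m) t ->
  den (Sem.RInv a) (ratV (1 # Pos.of_nat m)) t.
Proof.
  intros Hm Ha. apply (den_ratV_eq _ (toQ 1 0 m)); [|reflexivity].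
  apply den_Frac; [apply (den_Succ _ (nm 0)), den_Zero | apply den_Zero | assumption..].
Qed.

Lemma den_RAbs a p t : den a (ratV p) t -> den (Sem.RAbs a) (ratV (Qabs p)) t.
Proof.
  intros Ha. apply den_the. keep Ha. apply box_all. clear t Ha. intros t Ha u.
  apply (s_bind_den _ _ (ratV p)); [assumption|]. intros q' Eq. apply den_var in Eq.
  assert (HL : forall s, den (SVar q') (ratV p) s -> (Sem.RLt (SVar q') Sem.RZero s <-> p < 0)).
  { intros s Hs. apply RLt_spec; [assumption | apply den_RZero]. }
  assert (H1 : Sem.t_eq (SVar u) (SVar q') t <-> eqV u (ratV p) t).
  { apply t_eq_den; [apply den_refl | assumption]. }
  assert (H2 : Sem.t_eq (SVar u) (Sem.ROpp (SVar q')) t <-> eqV u (ratV (- p)) t).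
  { apply t_eq_den; [apply den_refl | apply den_ROpp, Eq]. }
  assert (HN : s_imp (Sem.RLt (SVar q') Sem.RZero) s_false t <-> ~ p < 0).
  { split.
    - intros H. apply box_incl in H. rewrite HL in H by exact Eq. exact H.
    - intros H. keep Eq. apply box_all. intros s Hs. rewrite HL by exact Hs. exact H. }
  change ((s_imp (Sem.RLt (SVar q') Sem.RZero) s_false t /\ Sem.t_eq (SVar u) (SVar q') t) \/
    (Sem.RLt (SVar q') Sem.RZero t /\ Sem.t_eq (SVar u) (Sem.ROpp (SVar q')) t) <->
    eqV u (ratV (Qabs p)) t).
  rewrite H1, H2, HN, (HL t Eq).
  destruct (Qlt_le_dec p 0) as [L | L].
  - assert (E : eqV (ratV (- p)) (ratV (Qabs p)) t).
    { apply ratV_eq. rewrite Qabs_neg by lra. reflexivity. }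
    split.
    + intros [[H _] | [_ H]]; [contradiction|]. eapply eqV_trans; eassumption.
    + intros H. right. split; [assumption|]. eapply eqV_trans; [exact H | apply eqV_sym, E].
  - assert (E : eqV (ratV p) (ratV (Qabs p)) t).
    { apply ratV_eq. rewrite Qabs_pos by lra. reflexivity. }
    split.
    + intros [[_ H] | [H _]]; [|lra]. eapply eqV_trans; eassumption.
    + intros H. left. split; [lra|]. eapply eqV_trans; [exact H | apply eqV_sym, E].
Qed.

Definition posrationalsV : V X := sup Q ratV (fun q => s_prop (0 < q)).

Lemma den_PosRationals t : den Sem.PosRationals posrationalsV t.
Proof.
  apply den_by_elements, box_all. clear t. intros t u. split.
  - intros [H1 H2]. apply (t_mem_var _ _ rationalsV) in H1; [|apply den_Rationals].
    apply memV_famV in H1. destruct H1 as [q E]. exists q. split; [|exact E].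
    apply (RLt_spec _ _ 0 q) in H2; [exact H2 | apply den_RZero | apply den_var, E].
  - intros [q [Hq E]]. split.
    + apply (t_mem_var _ _ rationalsV); [apply den_Rationals|]. apply memV_famV. eauto.
    + apply (RLt_spec _ _ 0 q); [apply den_RZero | apply den_var, E | exact Hq].
Qed.

Lemma all_in_PosRationals (F : V X -> Open X) t :
  Sem.all_in Sem.PosRationals F t <->
  box (fun s => forall q x, 0 < q -> eqV x (ratV q) s -> F x s) t.
Proof.
  rewrite (all_in_den _ posrationalsV) by apply den_PosRationals.
  split; apply box_mono; intros s H.
  - intros q x Hq E. apply H. exists q. split; assumption.
  - intros x [q [Hq E]]. exact (H q x Hq E).
Qed.

End Rationals.

(** * Sequences of rationals in the model *)

Section Sequences.
Context {X : Space}.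
Implicit Types (x y z u v f g A B : V X) (s t : pt) (a b c : sterm X) (p q : Q).

Definition value f (n : nat) q : Open X := memV (opairV (nm n) (ratV q)) f.

Definition is_sequence f : Open X := is_function f omegaV rationalsV.

Lemma Function_sequence f t : Sem.Function f Sem.Omega Sem.Rationals t <-> is_sequence f t.
Proof. apply Function_spec; [apply den_Omega | apply den_Rationals]. Qed.

Lemma sequence_total f n t : is_sequence f t -> exists q, value f n q t.
Proof.
  intros H. destruct (is_function_total _ _ _ (nm n) t H (memV_omegaV n t)) as [y [Hy Hf]].
  apply memV_famV in Hy. destruct Hy as [q E]. exists q.
  eapply memV_opairV_congr; [apply eqV_refl | exact E | exact Hf].
Qed.

Lemma sequence_unique f n p q t : is_sequence f t -> value f n p t -> value f n q t -> p == q.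
Proof.
  intros H Hp Hq. apply (ratV_eq _ _ t). eapply is_function_unique; [exact H | exact Hp | exact Hq].
Qed.

Lemma den_value f n q a b t :
  is_sequence f t -> value f n q t -> den a f t -> den b (nm n) t -> den (Sem.App a b) (ratV q) t.
Proof. intros H. apply (den_App _ _ _ _ _ _ _ _ H). Qed.

(** Congruence comes for free for the value of a formula. *)
Lemma Cauchy_congr f g t : eqV f g t -> Sem.Cauchy f t -> Sem.Cauchy g t.
Proof.
  intros E.
  assert (H : forall h, Sem.Cauchy h = ev (Cauchy 0%nat 1%nat) (scons h (fun _ => emptyV))).
  { intros h. symmetry. apply (tr_Cauchy (fun _ => emptyV) [h]), (denotes_level_new _ []). }
  rewrite (H f), (H g). apply ev_congr1, E.
Qed.

Lemma Cauchy_intro f t :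
  is_sequence f t ->
  box (fun s => forall e, 0 < e -> exists N, box (fun s => forall m n p q,
    (N < m)%nat -> (N < n)%nat -> value f m p s -> value f n q s -> Qabs (q - p) < e) s) t ->
  Sem.Cauchy f t.
Proof.
  intros Hf H. split; [apply Function_sequence, Hf|]. apply all_in_PosRationals.
  keep H. keep Hf. apply box_all. clear t H Hf. intros t Hf H e y He Ey. apply box_incl in H.
  destruct (H e He) as [N HN]. apply ex_in_Omega. exists N, (nm N).
  split; [apply eqV_refl|]. apply all_in_Omega. keep HN. keep Hf. keep Ey. apply box_all.
  clear t HN H Hf Ey. intros t Ey Hf HN m x Ex. apply all_in_Omega. keep HN. keep Hf. keep Ey.
  keep Ex. apply box_all. clear t HN Hf Ey Ex. intros t Ex Ey Hf HN n x' Ex'.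
  keep HN. keep Hf. keep Ey. keep Ex. keep Ex'. apply box_all. clear t HN Hf Ey Ex Ex'.
  intros t Ex' Ex Ey Hf HN [Hm Hn]. apply box_incl in HN. apply den_var in Ex, Ex', Ey.
  apply (t_mem_den _ _ (nm N) (nm m)) in Hm; [|apply den_refl | exact Ex].
  apply (t_mem_den _ _ (nm N) (nm n)) in Hn; [|apply den_refl | exact Ex'].
  apply nm_mem in Hm, Hn.
  destruct (sequence_total f m t Hf) as [p Hp]. destruct (sequence_total f n t Hf) as [q Hq].
  apply (RLt_spec _ _ (Qabs (q - p)) e); [|exact Ey | apply (HN m n p q); assumption].
  apply den_RAbs, den_RSub; (eapply den_value; [exact Hf | eassumption | apply den_refl | assumption]).
Qed.

Definition graphV (R : nat -> Q -> Open X) : V X :=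
  relV (fun i : nat * Q => nm (fst i)) (fun i => ratV (snd i)) (fun i => R (fst i) (snd i)).

Lemma value_graphV R n q t :
  value (graphV R) n q t <-> exists q', R n q' t /\ q == q'.
Proof.
  unfold value, graphV. rewrite memV_relV. split.
  - intros [[n' q'] [H [En Eq]]]. simpl in *. apply nm_eq in En. apply ratV_eq in Eq. subst n'.
    eauto.
  - intros [q' [H Eq]]. exists (n, q'). split; [exact H|]. split; [apply eqV_refl | apply ratV_eq, Eq].
Qed.

Lemma is_sequence_graphV (R : nat -> Q -> Open X) t :
  box (fun s => forall n, (exists q, R n q s) /\
    (forall p q, R n p s -> R n q s -> p == q)) t ->
  is_sequence (graphV R) t.
Proof.
  intros H. apply is_function_relV. keep H. apply box_all. clear t H. intros t H.
  apply box_incl in H. split; [|split].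
  - intros i _. split; [apply memV_omegaV | apply memV_rationalsV].
  - intros x Hx. apply memV_famV in Hx. destruct Hx as [n En].
    destruct (proj1 (H n)) as [q Hq]. exists (n, q). split; assumption.
  - intros [m p] [n q] Hp Hq E. simpl in *. apply nm_eq in E. subst n. apply ratV_eq.
    apply (proj2 (H m)); assumption.
Qed.

Lemma sequence_ext f g t : is_sequence f t -> is_sequence g t ->
  box (fun s => forall n, exists q, value f n q s /\ value g n q s) t -> eqV f g t.
Proof.
  intros Hf Hg H. eapply is_function_ext; [exact Hf | exact Hg|]. revert H. apply box_mono.
  intros s H x Hx. apply memV_famV in Hx. destruct Hx as [n En].
  destruct (H n) as [q [H1 H2]]. exists (ratV q).
  split; (eapply memV_opairV_congr; [apply eqV_sym, En | apply eqV_refl | assumption]).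
Qed.

Lemma sequence_eq_graphV f t : is_sequence f t -> eqV f (graphV (value f)) t.
Proof.
  intros Hf. apply sequence_ext; [assumption | |].
  - apply is_sequence_graphV. keep Hf. apply box_all. clear t Hf. intros t Hf n.
    split; [apply sequence_total, Hf|]. intros p q. apply sequence_unique, Hf.
  - keep Hf. apply box_all. clear t Hf. intros t Hf n.
    destruct (sequence_total f n t Hf) as [q Hq]. exists q. split; [assumption|].
    apply value_graphV. exists q. split; [assumption | reflexivity].
Qed.

(** A sequence is determined by the truth values of the statements that its term at [n]
    is [q], so the families of such truth values index a set of all Cauchy sequences. *)
Definition cauchysequencesV : V X :=
  sup (nat -> Q -> Open X) graphV (fun R => Sem.Cauchy (graphV R)).

Lemma memV_cauchysequencesV f t : Sem.Cauchy f t -> memV f cauchysequencesV t.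
Proof.
  intros H. assert (Hf := proj1 H). apply Function_sequence, sequence_eq_graphV in Hf.
  exists (value f). split; [|exact Hf]. eapply Cauchy_congr; eassumption.
Qed.

Lemma den_CauchySequences t : den Sem.CauchySequences cauchysequencesV t.
Proof.
  apply den_by_elements, box_all. clear t. intros t f.
  split; [apply memV_cauchysequencesV|].
  intros [R [HR E]]. eapply Cauchy_congr; [apply eqV_sym, E | exact HR].
Qed.

(** [Dist] and [Const] both describe a sequence through its terms. *)
Definition describedV (G : V X -> sterm X) : V X := graphV (fun n q => den (G (nm n)) (ratV q)).

Lemma den_sequence (G : V X -> sterm X) t :
  box (fun s => forall n, exists q, forall x, eqV x (nm n) s -> den (G x) (ratV q) s) t ->
  is_sequence (describedV G) t /\
  den (SThe (fun d => s_and (Sem.Function d Sem.Omega Sem.Rationals)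
    (Sem.all_in Sem.Omega (fun n => Sem.t_eq (Sem.App (SVar d) (SVar n)) (G n)))))
    (describedV G) t.
Proof.
  intros H.
  assert (HD : forall s, box (fun s => forall n, exists q, forall x, eqV x (nm n) s ->
    den (G x) (ratV q) s) s -> is_sequence (describedV G) s).
  { clear t H. intros t H. apply is_sequence_graphV. keep H. apply box_all. clear t H.
    intros t H n. apply box_incl in H. split.
    - destruct (H n) as [q Hq]. exists q. apply Hq, eqV_refl.
    - intros p q Hp Hq. apply (ratV_eq p q t). eapply den_unique; eassumption. }
  split; [apply HD, H|].
  apply den_the. keep H. apply box_all. clear t H. intros t H d.
  assert (H0 := HD t H). split.
  - intros [Hd Ht]. apply Function_sequence in Hd. apply all_in_Omega in Ht.
    apply sequence_ext; [assumption | assumption |].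
    keep H. keep H0. keep Hd. keep Ht. apply box_all. clear t H H0 Hd Ht.
    intros t Ht Hd H0 H n. apply box_incl in H, Ht. destruct (H n) as [q Hq].
    exists q. split.
    + destruct (sequence_total d n t Hd) as [p Hp]. specialize (Ht n (nm n) (eqV_refl _ _)).
      apply (t_eq_den _ _ (ratV p) (ratV q)) in Ht.
      * eapply memV_opairV_congr; [apply eqV_refl | exact Ht | exact Hp].
      * eapply den_value; [exact Hd | exact Hp | apply den_refl | apply den_refl].
      * apply Hq, eqV_refl.
    + apply value_graphV. exists q. split; [apply Hq, eqV_refl | reflexivity].
  - intros E. split.
    + apply Function_sequence. eapply is_function_congr; [apply eqV_sym, E | exact H0].
    + apply all_in_Omega. keep H. keep H0. keep E. apply box_all. clear t H H0 E.
      intros t E H0 H n x Ex. apply box_incl in H. destruct (H n) as [q Hq].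
      apply (t_eq_den _ _ (ratV q) (ratV q)); [| |apply eqV_refl].
      * apply (den_value (describedV G) n q); [exact H0 | | apply den_var, E | apply den_var, Ex].
        apply value_graphV. exists q. split; [apply Hq, eqV_refl | reflexivity].
      * apply Hq, Ex.
Qed.

Lemma value_describedV (G : V X -> sterm X) n q t :
  den (G (nm n)) (ratV q) t -> value (describedV G) n q t.
Proof. intros H. apply value_graphV. exists q. split; [exact H | reflexivity]. Qed.

Definition distV a b : V X :=
  describedV (fun n => Sem.RAbs (Sem.RSub (Sem.App a (SVar n)) (Sem.App b (SVar n)))).

Lemma den_distance a b f g n p q t x :
  is_sequence f t -> is_sequence g t -> den a f t -> den b g t ->
  value f n p t -> value g n q t -> eqV x (nm n) t ->
  den (Sem.RAbs (Sem.RSub (Sem.App a (SVar x)) (Sem.App b (SVar x)))) (ratV (Qabs (p - q))) t.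
Proof.
  intros Hf Hg Ha Hb Hp Hq Ex. apply den_RAbs, den_RSub.
  - apply (den_value f n p); auto using den_var.
  - apply (den_value g n q); auto using den_var.
Qed.

Lemma den_Dist a b f g t :
  is_sequence f t -> is_sequence g t -> den a f t -> den b g t ->
  is_sequence (distV a b) t /\ den (Sem.Dist a b) (distV a b) t.
Proof.
  intros Hf Hg Ha Hb. apply den_sequence. keep Hf. keep Hg. keep Ha. keep Hb. apply box_all.
  clear t Hf Hg Ha Hb. intros t Hb Ha Hg Hf n.
  destruct (sequence_total f n t Hf) as [p Hp]. destruct (sequence_total g n t Hg) as [q Hq].
  exists (Qabs (p - q)). intros x Ex. apply (den_distance a b f g n); assumption.
Qed.

Lemma den_Const a q t : den a (ratV q) t ->
  is_sequence (describedV (fun _ => a)) t /\ den (Sem.Const a) (describedV (fun _ => a)) t.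
Proof.
  intros Ha. apply den_sequence. keep Ha. apply box_all. clear t Ha. intros t Ha n.
  exists q. auto.
Qed.

Lemma SeqLt_Dist_Const a b c f g e t :
  is_sequence f t -> is_sequence g t -> den a f t -> den b g t -> den c (ratV e) t ->
  (Sem.SeqLt (Sem.Dist a b) (Sem.Const c) t <->
   exists m N, (0 < m)%nat /\ box (fun s => forall k p q, (N < k)%nat ->
     value f k p s -> value g k q s -> Qabs (p - q) + (1 # Pos.of_nat m) < e) t).
Proof.
  intros Hf Hg Ha Hb Hc.
  assert (HT : forall s m k p q x y, is_sequence f s -> is_sequence g s ->
    den a f s -> den b g s -> den c (ratV e) s ->
    value f k p s -> value g k q s -> (0 < m)%nat -> eqV x (nm m) s -> eqV y (nm k) s ->
    (Sem.RLt (Sem.RAdd (Sem.App (Sem.Dist a b) (SVar y)) (Sem.RInv (SVar x)))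
       (Sem.App (Sem.Const c) (SVar y)) s <-> Qabs (p - q) + (1 # Pos.of_nat m) < e)).
  { clear t Hf Hg Ha Hb Hc. intros t m k p q x y Hf Hg Ha Hb Hc Hp Hq Hm Ex Ey.
    destruct (den_Dist a b f g t Hf Hg Ha Hb) as [Sd Dd].
    destruct (den_Const c e t Hc) as [Sc Dc].
    apply RLt_spec.
    - apply den_RAdd; [|apply den_RInv; [assumption | apply den_var, Ex]].
      eapply den_value; [exact Sd | | exact Dd | apply den_var, Ey].
      apply value_describedV, (den_distance a b f g k); auto using eqV_refl.
    - eapply den_value; [exact Sc | | exact Dc | apply den_var, Ey].
      apply value_describedV, Hc. }
  unfold Sem.SeqLt. split.
  - intros H. apply ex_in_Omega in H. destruct H as [m [x [Ex H]]].
    apply ex_in_Omega in H. destruct H as [N [y [Ey [Hm H]]]].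
    apply (Zero_lt _ m) in Hm; [|apply den_var, Ex].
    exists m, N. split; [assumption|]. apply all_in_Omega in H.
    keep H. keep Hf. keep Hg. keep Ha. keep Hb. keep Hc. keep Ex. keep Ey. apply box_all.
    clear t H Hf Hg Ha Hb Hc Ex Ey. intros t Ey Ex Hc Hb Ha Hg Hf H k p q Hk Hp Hq.
    apply box_incl in H. specialize (H k (nm k) (eqV_refl _ _)). apply box_incl in H.
    apply (HT t m k p q x (nm k)); auto using eqV_refl. apply H.
    apply (t_mem_den _ _ (nm N) (nm k)); [apply den_var, Ey | apply den_refl|].
    apply nm_mem, Hk.
  - intros [m [N [Hm H]]]. apply ex_in_Omega. exists m, (nm m). split; [apply eqV_refl|].
    apply ex_in_Omega. exists N, (nm N). split; [apply eqV_refl|].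
    split; [apply (Zero_lt _ m); [apply den_refl | assumption]|].
    apply all_in_Omega. keep H. keep Hf. keep Hg. keep Ha. keep Hb. keep Hc. apply box_all.
    clear t H Hf Hg Ha Hb Hc. intros t Hc Hb Ha Hg Hf H k y Ey.
    keep H. keep Hf. keep Hg. keep Ha. keep Hb. keep Hc. keep Ey. apply box_all.
    clear t H Hf Hg Ha Hb Hc Ey. intros t Ey Hc Hb Ha Hg Hf H Hk.
    apply (t_mem_den _ _ (nm N) (nm k)) in Hk; [|apply den_refl | apply den_var, Ey].
    apply nm_mem in Hk. apply box_incl in H.
    destruct (sequence_total f k t Hf) as [p Hp]. destruct (sequence_total g k t Hg) as [q Hq].
    apply (HT t m k p q); auto using eqV_refl. apply (H k); assumption.
Qed.

End Sequences.

(** * A constant sequence of Cauchy sequences *)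

Section ConstantSequence.
Context {X : Space}.
Implicit Types (x y z u v f g A B : V X) (s t : pt) (a b c : sterm X) (p q : Q).

Definition constantV f : V X := relV nm (fun _ => f) (fun _ => s_prop True).

Lemma is_function_constantV f t : Sem.Cauchy f t ->
  is_function (constantV f) omegaV cauchysequencesV t.
Proof.
  intros Hf. apply is_function_relV. keep Hf. apply box_all. clear t Hf. intros t Hf.
  split; [|split].
  - intros n _. split; [apply memV_omegaV | apply memV_cauchysequencesV, Hf].
  - intros x Hx. apply memV_famV in Hx. destruct Hx as [n En]. exists n. split; [exact I | exact En].
  - intros m n _ _ _. apply eqV_refl.
Qed.

Lemma den_constantV f j x t : Sem.Cauchy f t -> eqV x (nm j) t ->
  den (Sem.App (SVar (constantV f)) (SVar x)) f t.
Proof.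
  intros Hf Ex. eapply den_App; [apply is_function_constantV, Hf | | apply den_refl | apply den_var, Ex].
  apply memV_relV. exists j. split; [exact I | split; apply eqV_refl].
Qed.

Lemma unit_fraction_below q : 0 < q -> exists m, (0 < m)%nat /\ (1 # Pos.of_nat m) < q.
Proof.
  destruct q as [n d]. unfold Qlt. simpl. intros H. exists (S (Pos.to_nat d)).
  split; [lia|]. cbn [Qnum Qden]. rewrite pos_of_nat by lia.
  rewrite Nat2Z.inj_succ, positive_nat_Z. nia.
Qed.

(** The distance of a sequence from itself is 0, which is below [e] by a unit fraction. *)
Lemma constantV_close f j k x y c e t : Sem.Cauchy f t -> 0 < e ->
  eqV x (nm j) t -> eqV y (nm k) t -> den c (ratV e) t ->
  Sem.SeqLt (Sem.Dist (Sem.App (SVar (constantV f)) (SVar x))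
    (Sem.App (SVar (constantV f)) (SVar y))) (Sem.Const c) t.
Proof.
  intros Hf He Ex Ey Hc. assert (Sf := proj1 Hf). apply Function_sequence in Sf.
  apply (SeqLt_Dist_Const _ _ _ f f e); eauto using den_constantV.
  destruct (unit_fraction_below e He) as [m [Hm Hme]]. exists m, 0%nat.
  split; [assumption|]. keep Sf. apply box_all. clear t Hf Sf Ex Ey Hc.
  intros t Sf k' p q _ Hp Hq. assert (E := sequence_unique f k' p q t Sf Hp Hq).
  rewrite E. setoid_replace (q - q) with 0 by ring. simpl Qabs. lra.
Qed.

Lemma constantV_CauchySeqOfSeqs f t : Sem.Cauchy f t -> Sem.CauchySeqOfSeqs (constantV f) t.
Proof.
  intros Hf. split.
  - apply (Function_spec _ _ _ omegaV cauchysequencesV);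
      [apply den_Omega | apply den_CauchySequences | apply is_function_constantV, Hf].
  - apply all_in_PosRationals. keep Hf. apply box_all. clear t Hf. intros t Hf e y He Ey.
    apply ex_in_Omega. exists 0%nat, (nm 0). split; [apply eqV_refl|].
    apply all_in_Omega. keep Hf. keep Ey. apply box_all. clear t Hf Ey. intros t Ey Hf j x Ex.
    apply all_in_Omega. keep Hf. keep Ey. keep Ex. apply box_all. clear t Hf Ey Ex.
    intros t Ex Ey Hf k x' Ex'.
    keep Hf. keep Ey. keep Ex. keep Ex'. apply box_all. clear t Hf Ey Ex Ex'.
    intros t Ex' Ex Ey Hf _. eapply constantV_close; eauto using den_var.
Qed.

Definition zeroV : V X :=
  relV ratV (fun _ => nm 0) (fun q => s_prop (0 < q)).

Lemma constantV_ModulusOfSeqs f t : Sem.Cauchy f t -> Sem.ModulusOfSeqs zeroV (constantV f) t.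
Proof.
  intros Hf. split.
  - apply (Function_spec _ _ _ posrationalsV omegaV);
      [apply den_PosRationals | apply den_Omega | apply is_function_relV, box_all].
    clear t Hf. intros t. split; [|split].
    + intros q Hq. split; [exists q; split; [exact Hq | apply eqV_refl] | apply memV_omegaV].
    + intros x [q [Hq E]]. exists q. split; assumption.
    + intros p q _ _ _. apply eqV_refl.
  - apply all_in_PosRationals. keep Hf. apply box_all. clear t Hf. intros t Hf e y He Ey.
    apply all_in_Omega. keep Hf. keep Ey. apply box_all. clear t Hf Ey. intros t Ey Hf j x Ex.
    apply all_in_Omega. keep Hf. keep Ey. keep Ex. apply box_all. clear t Hf Ey Ex.
    intros t Ex Ey Hf k x' Ex'.
    keep Hf. keep Ey. keep Ex. keep Ex'. apply box_all. clear t Hf Ey Ex Ex'.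
    intros t Ex' Ex Ey Hf _. eapply constantV_close; eauto using den_var.
Qed.

(** The term just beyond the index that the modulus gives for [e] is within [e] of the
    limit, and it is a locally constant function of the point. *)
Definition approximant g f e q : Open X :=
  s_ex (fun N => s_and (memV (opairV (ratV e) (nm N)) g) (value f (S N) q)).

Lemma is_modulus_value g e t : is_function g posrationalsV omegaV t -> 0 < e ->
  exists N, memV (opairV (ratV e) (nm N)) g t.
Proof.
  intros Hg He. destruct (is_function_total _ _ _ (ratV e) t Hg) as [y [Hy H]].
  { exists e. split; [exact He | apply eqV_refl]. }
  apply memV_famV in Hy. destruct Hy as [N E]. exists N.
  eapply memV_opairV_congr; [apply eqV_refl | exact E | exact H].
Qed.

Lemma approximant_unique g f e p q t :
  Sem.Modulus g f t -> is_sequence f t ->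
  approximant g f e p t -> approximant g f e q t -> p == q.
Proof.
  intros [Hg _] Hf [M [HM Hp]] [N [HN Hq]].
  apply (Function_spec _ _ _ posrationalsV omegaV) in Hg; [|apply den_PosRationals | apply den_Omega].
  assert (E := is_function_unique _ _ _ _ _ _ _ Hg HM HN). apply nm_eq in E. subst N.
  eapply sequence_unique; eassumption.
Qed.

Lemma approximant_exists g f e t :
  Sem.Modulus g f t -> is_sequence f t -> 0 < e -> exists q, approximant g f e q t.
Proof.
  intros [Hg _] Hf He.
  apply (Function_spec _ _ _ posrationalsV omegaV) in Hg; [|apply den_PosRationals | apply den_Omega].
  destruct (is_modulus_value g e t Hg He) as [N HN].
  destruct (sequence_total f (S N) t Hf) as [q Hq]. exists q, N. split; assumption.
Qed.

Lemma Modulus_close g f e N m n p q t :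
  Sem.Modulus g f t -> is_sequence f t -> 0 < e -> memV (opairV (ratV e) (nm N)) g t ->
  (N < m)%nat -> (N < n)%nat -> value f m p t -> value f n q t -> Qabs (q - p) < e.
Proof.
  intros [Hg H] Hf He HN Hm Hn Hp Hq.
  apply (Function_spec _ _ _ posrationalsV omegaV) in Hg; [|apply den_PosRationals | apply den_Omega].
  apply all_in_PosRationals, box_incl in H. specialize (H e (ratV e) He (eqV_refl _ _)).
  apply all_in_Omega, box_incl in H. specialize (H m (nm m) (eqV_refl _ _)).
  apply all_in_Omega, box_incl in H. specialize (H n (nm n) (eqV_refl _ _)).
  apply box_incl in H.
  assert (D : den (Sem.App (SVar g) (SVar (ratV e))) (nm N) t).
  { eapply den_App; [exact Hg | exact HN | apply den_refl | apply den_refl]. }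
  apply (RLt_spec _ _ (Qabs (q - p)) e t) in H.
  - exact H.
  - apply den_RAbs, den_RSub.
    + apply (den_value f n q); auto using den_refl.
    + apply (den_value f m p); auto using den_refl.
  - apply den_refl.
  - split; (apply (t_mem_den _ _ (nm N) _ t D (den_refl _ _)); apply nm_mem; assumption).
Qed.

Lemma ConvergesTo_constantV f h e t :
  Sem.Cauchy f t -> is_sequence h t -> Sem.ConvergesTo (constantV f) h t -> 0 < e ->
  exists N, forall k p q, (N < k)%nat -> value f k p t -> value h k q t -> Qabs (p - q) < e.
Proof.
  intros Hf Hh H He. assert (Sf := proj1 Hf). apply Function_sequence in Sf.
  apply all_in_PosRationals, box_incl in H. specialize (H e (ratV e) He (eqV_refl _ _)).
  apply ex_in_Omega in H. destruct H as [M [x [Ex H]]].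
  apply all_in_Omega, box_incl in H. specialize (H (S M) (nm (S M)) (eqV_refl _ _)).
  apply box_incl in H.
  assert (HM : Sem.t_mem (SVar x) (SVar (nm (S M))) t).
  { apply (t_mem_den _ _ (nm M) (nm (S M))); [apply den_var, Ex | apply den_refl|].
    apply nm_mem. lia. }
  apply H in HM.
  apply (SeqLt_Dist_Const _ _ _ f h e) in HM; auto using den_refl.
  - destruct HM as [m [N [_ HN]]]. apply box_incl in HN. exists N. intros k p q Hk Hp Hq.
    specialize (HN k p q Hk Hp Hq).
    assert (0 < (1 # Pos.of_nat m)) by reflexivity. lra.
  - eapply den_constantV; [exact Hf | apply eqV_refl].
Qed.

(** Cauchy completeness turns a Cauchy sequence, repeated for ever, into rational
    approximations to its limit that are locally constant and uniform. *)
Lemma completeness_approximates f t :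
  (forall s, Sem.Cauchy f s) -> Sem.cauchy_completeness t ->
  exists H : Q -> Q -> Open X, box (fun s => forall e, 0 < e ->
    (exists q, H e q s) /\
    (forall p q, H e p s -> H e q s -> p == q) /\
    (forall q, H e q s ->
       exists K, forall k p, (K < k)%nat -> value f k p s -> Qabs (p - q) < 2 * e)) t.
Proof.
  intros Hf HC. apply box_incl in HC. specialize (HC (constantV f)). apply box_incl in HC.
  destruct HC as [h [Hh [[g Hg] Hconv]]].
  { split; [apply constantV_CauchySeqOfSeqs, Hf | exists zeroV; apply constantV_ModulusOfSeqs, Hf]. }
  exists (approximant g h). keep Hh. keep Hg. keep Hconv. apply box_all.
  clear t Hh Hg Hconv. intros t Hconv Hg Hh e He. assert (Sh := proj1 Hh).
  apply Function_sequence in Sh. split; [|split].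
  - apply approximant_exists; assumption.
  - intros p q. apply approximant_unique; assumption.
  - intros q [N [HN Hq]].
    destruct (ConvergesTo_constantV f h e t (Hf t) Sh Hconv He) as [M HM].
    exists (M + S N)%nat. intros k p Hk Hp.
    destruct (sequence_total h k t Sh) as [r Hr].
    assert (H1 : Qabs (p - r) < e) by (apply (HM k); trivial; lia).
    assert (H2 : Qabs (r - q) < e) by (apply (Modulus_close g h e N (S N) k q r t); trivial; lia).
    apply Qle_lt_trans with (Qabs (p - r) + Qabs (r - q)); [|lra].
    setoid_replace (p - q) with ((p - r) + (r - q)) by ring. apply Qabs_triangle.
Qed.

End ConstantSequence.

(** * The space of monotone sequences *)

Record monotone := {
  term_of :> nat -> Q;
  term_le : forall m n, (m <= n)%nat -> term_of m <= term_of n;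
  term_bounded : exists b, forall n, term_of n <= b }.

(** This says that the limit is less than [b]; a strict bound on the terms alone would not
    define an open set. *)
Definition below (b : Q) (s : monotone) : Prop := exists c, c < b /\ forall n, s n <= c.
Definition agree (k : nat) (s s' : monotone) : Prop := forall i, (i < k)%nat -> s' i = s i.
Definition ball (k : nat) (b : Q) (s s' : monotone) : Prop := agree k s s' /\ below b s'.

Definition near (P : monotone -> Prop) (s : monotone) : Prop :=
  exists k b, below b s /\ forall s', ball k b s s' -> P s'.

Lemma agree_refl k s : agree k s s.
Proof. intros i _. reflexivity. Qed.

Lemma agree_trans k s s' s'' : agree k s s' -> agree k s' s'' -> agree k s s''.
Proof. intros H H' i Hi. rewrite (H' i Hi). apply H, Hi. Qed.

Lemma agree_weaken k k' s s' : (k <= k')%nat -> agree k' s s' -> agree k s s'.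
Proof. intros Hk H i Hi. apply H. lia. Qed.

Lemma below_weaken b b' s : b <= b' -> below b s -> below b' s.
Proof. intros Hb [c [Hc H]]. exists c. split; [lra | exact H]. Qed.

Lemma near_incl P s : near P s -> P s.
Proof. intros [k [b [Hb H]]]. apply H. split; [apply agree_refl | exact Hb]. Qed.

Lemma near_mono (P P' : monotone -> Prop) s : (forall s, P s -> P' s) -> near P s -> near P' s.
Proof. intros HP [k [b [Hb H]]]. exists k, b. auto. Qed.

Lemma near_near P s : near P s -> near (near P) s.
Proof.
  intros [k [b [Hb H]]]. exists k, b. split; [exact Hb|]. intros s' [Hk Hs'].
  exists k, b. split; [exact Hs'|]. intros s'' [Hk' Hs'']. apply H.
  split; [eapply agree_trans; eassumption | exact Hs''].
Qed.

Lemma near_and P P' s : near P s -> near P' s -> near (fun s => P s /\ P' s) s.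
Proof.
  intros [k [b [Hb H]]] [k' [b' [Hb' H']]]. exists (Nat.max k k').
  destruct (Qlt_le_dec b b') as [L | L]; [exists b | exists b'];
    (split; [assumption|]); intros s' [Hk Hs]; split;
    (apply H || apply H'); (split;
      [eapply agree_weaken; [|exact Hk]; lia | eapply below_weaken; [|exact Hs]; lra]).
Qed.

Lemma near_all (P : monotone -> Prop) s : (forall s, P s) -> near P s.
Proof.
  intros H. destruct (term_bounded s) as [b Hb]. exists 0%nat, (b + 1).
  split; [|auto]. exists b. split; [lra | exact Hb].
Qed.

Definition monotone_space : Space :=
  Build_Space monotone near near_incl near_mono near_near near_and near_all.
#[local] Existing Instance monotone_space.

Program Definition term_is (n : nat) (q : Q) : Open monotone_space :=
  {| holds := fun s : monotone => s n = q |}.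
Next Obligation.
  destruct (term_bounded t) as [b Hb]. exists (S n), (b + 1).
  split; [exists b; split; [lra | exact Hb]|]. intros s' [H _]. apply H. lia.
Qed.

Definition genericV : V monotone_space := graphV term_is.

Lemma genericV_value n q (s : monotone) : value genericV n q s <-> q == s n.
Proof.
  unfold genericV. rewrite value_graphV. split.
  - intros [q' [<- E]]. exact E.
  - intros E. exists (s n). split; [reflexivity | exact E].
Qed.

Lemma bounded_no_gain (v : nat -> Q) d b : 0 < d ->
  (forall i, v i + d <= v (S i)) -> (forall i, v i <= b) -> False.
Proof.
  intros Hd Hv Hb.
  assert (H : forall i, v 0%nat + inject_Z (Z.of_nat i) * d <= v i).
  { induction i as [|i IH]; [change (inject_Z (Z.of_nat 0)) with 0; lra|]. specialize (Hv i).
    rewrite Nat2Z.inj_succ. unfold Z.succ. rewrite inject_Z_plus.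
    change (inject_Z 1) with 1. generalize dependent (inject_Z (Z.of_nat i)).
    intros x IH. lra. }
  set (x := (b - v 0%nat) / d).
  assert (Hx : x * d == b - v 0%nat) by (unfold x; field; lra).
  set (i := Z.to_nat (Qfloor x + 1)).
  assert (Hi : x < inject_Z (Z.of_nat i)).
  { apply Qlt_le_trans with (inject_Z (Qfloor x + 1)); [apply Qlt_floor|].
    rewrite <- Zle_Qle. lia. }
  specialize (H i). specialize (Hb i).
  assert (x * d < inject_Z (Z.of_nat i) * d) by (apply Qmult_lt_compat_r; assumption).
  lra.
Qed.

Lemma genericV_Cauchy s : Sem.Cauchy genericV s.
Proof.
  apply Cauchy_intro.
  - apply is_sequence_graphV, box_all. clear s. intros s n. split.
    + exists (s n). reflexivity.
    + intros p q Hp Hq. simpl in Hp, Hq. rewrite <- Hp, <- Hq. reflexivity.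
  - apply box_all. clear s. intros s e He.
    (* otherwise the sequence would grow by half of e infinitely often *)
    assert (HN : exists N, forall n, (N <= n)%nat -> s n <= s N + e * (1 # 2)).
    { apply NNPP. intros Hno.
      assert (Hstep : forall N, exists n, s N + e * (1 # 2) <= s n).
      { intros N. apply NNPP. intros Hn. apply Hno. exists N. intros n _.
        destruct (Qlt_le_dec (s N + e * (1 # 2)) (s n)) as [L | L]; [|exact L].
        exfalso. apply Hn. exists n. lra. }
      set (next := fun N => proj1_sig (constructive_indefinite_description _ (Hstep N))).
      destruct (term_bounded s) as [b Hb].
      apply (bounded_no_gain (fun i => s (Nat.iter i next 0%nat)) (e * (1 # 2)) b).
      - lra.
      - intros i. simpl. unfold next at 2.
        destruct (constructive_indefinite_description _ (Hstep (Nat.iter i next 0%nat))).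
        assumption.
      - intros i. apply Hb. }
    destruct HN as [N HN]. exists N.
    assert (Hb : below (s N + e) s).
    { exists (s N + e * (1 # 2)). split; [lra|]. intros n. destruct (le_lt_dec N n) as [L | L].
      - apply HN, L.
      - assert (s n <= s N) by (apply term_le; lia). lra. }
    exists (S N), (s N + e). split; [exact Hb|]. intros s' [Hs' [c [Hc Hbs']]] m n p q Hm Hn Hp Hq.
    apply genericV_value in Hp, Hq. rewrite Hp, Hq.
    assert (EN : s' N = s N) by (apply Hs'; lia).
    assert (s N <= s' m) by (rewrite <- EN; apply term_le; lia).
    assert (s N <= s' n) by (rewrite <- EN; apply term_le; lia).
    pose proof (Hbs' m). pose proof (Hbs' n).
    apply Qabs_case; intros; lra.
Qed.

(** * The limit has no locally constant approximation *)

Definition settled (k : nat) (s : monotone) : Prop := forall n, (k <= n)%nat -> s n = s k.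

Lemma settled_le k s n : settled k s -> s n <= s k.
Proof.
  intros H. destruct (le_lt_dec n k) as [L | L]; [apply term_le, L|].
  rewrite (H n) by lia. apply Qle_refl.
Qed.

Lemma jump (s : monotone) k w : s k <= w ->
  exists z : monotone, agree (S k) s z /\ settled (S k) z /\ z (S k) = w.
Proof.
  intros Hw.
  set (f := fun n => if le_lt_dec n k then s n else w).
  assert (Hf : forall n, f n <= w).
  { intros n. unfold f. destruct (le_lt_dec n k); [|apply Qle_refl].
    apply Qle_trans with (s k); [apply term_le|]; assumption. }
  assert (Hlow : forall n, (n <= k)%nat -> f n = s n).
  { intros n H. unfold f. destruct (le_lt_dec n k); [reflexivity | lia]. }
  assert (Hhigh : forall n, (k < n)%nat -> f n = w).
  { intros n H. unfold f. destruct (le_lt_dec n k); [lia | reflexivity]. }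
  assert (Hmono : forall m n, (m <= n)%nat -> f m <= f n).
  { intros m n H. destruct (le_lt_dec n k) as [L | L].
    - rewrite !Hlow by lia. apply term_le, H.
    - rewrite (Hhigh n L). apply Hf. }
  exists {| term_of := f; term_le := Hmono; term_bounded := ex_intro _ w Hf |}.
  split; [|split].
  - intros i Hi. apply Hlow. lia.
  - intros n Hn. simpl. rewrite !Hhigh by lia. reflexivity.
  - apply Hhigh. lia.
Qed.

(** Otherwise the gain could be more than doubled again and again, against the bound. *)
Lemma greedy_step {A : Type} (R : A -> Prop) (gain : A -> Q) b y0 :
  R y0 -> (forall y, R y -> 0 <= gain y <= b) ->
  exists y, R y /\ forall z, R z -> gain z <= 2 * gain y.
Proof.
  intros H0 Hgain. apply NNPP. intros Hno.
  assert (Hbetter : forall y, R y -> exists z, R z /\ 2 * gain y < gain z).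
  { intros y Hy. apply NNPP. intros Hn. apply Hno. exists y. split; [assumption|].
    intros z Hz. destruct (Qlt_le_dec (2 * gain y) (gain z)); [|assumption].
    exfalso. apply Hn. eauto. }
  destruct (Hbetter y0 H0) as [y1 [H1 G1]]. pose proof (proj1 (Hgain y0 H0)).
  assert (Hstep : forall y : {y | R y /\ gain y1 <= gain y},
    exists z : {z | R z /\ gain y1 <= gain z}, gain (proj1_sig y) + gain y1 <= gain (proj1_sig z)).
  { intros [y [Hy Gy]]. simpl. destruct (Hbetter y Hy) as [z [Hz Gz]].
    assert (G : gain y1 <= gain z) by lra. exists (exist _ z (conj Hz G)). simpl. lra. }
  set (next := fun y => proj1_sig (constructive_indefinite_description _ (Hstep y))).
  set (seq := fun i => Nat.iter i next (exist _ y1 (conj H1 (Qle_refl _)))).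
  apply (bounded_no_gain (fun i => gain (proj1_sig (seq i))) (gain y1) b).
  - lra.
  - intros i. exact (proj2_sig (constructive_indefinite_description _ (Hstep (seq i)))).
  - intros i. apply Hgain, (proj2_sig (seq i)).
Qed.

(** A greedy climb inside [P] would converge to a point of the ball at which [P] can be
    neither true nor false. *)
Lemma climb (P : monotone -> Prop) k0 b0 (s0 : monotone) k :
  (forall s, ball k0 b0 s0 s -> near P s \/ near (fun s => ~ P s) s) ->
  below b0 s0 -> settled k s0 -> P s0 ->
  forall b, b < b0 -> exists s l, ball k0 b0 s0 s /\ settled l s /\ P s /\ b < s l.
Proof.
  intros Hclopen Hs0 Hk HP b Hb. apply NNPP. intros Hno.
  set (st := fun x : monotone * nat =>
    ball k0 b0 s0 (fst x) /\ settled (snd x) (fst x) /\ P (fst x) /\ (k0 <= snd x)%nat).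
  set (val := fun x : monotone * nat => fst x (snd x)).
  assert (Hval : forall x, st x -> val x <= b).
  { intros x [H1 [H2 [H3 _]]]. unfold val.
    destruct (Qlt_le_dec b (fst x (snd x))) as [L | L]; [|exact L].
    exfalso. apply Hno. exists (fst x), (snd x). auto. }
  set (ext := fun x y : monotone * nat =>
    st y /\ (snd x < snd y)%nat /\ agree (S (snd x)) (fst x) (fst y)).
  assert (Hext : forall x y, ext x y -> val x <= val y).
  { intros x y [_ [H1 H2]]. unfold val. rewrite <- (H2 (snd x)) by lia. apply term_le. lia. }
  assert (Hgreedy : forall x : {x | st x}, exists y : {y | st y}, ext (proj1_sig x) (proj1_sig y) /\
    forall z, ext (proj1_sig x) z ->
      val z - val (proj1_sig x) <= 2 * (val (proj1_sig y) - val (proj1_sig x))).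
  { intros [x Hx]. simpl.
    destruct (greedy_step (ext x) (fun y => val y - val x) (b - val x) (fst x, S (snd x)))
      as [y [Hy Hmax]].
    - destruct Hx as [H1 [H2 [H3 H4]]]. split; [|split; simpl; [lia | apply agree_refl]].
      repeat split; simpl; try assumption; try lia; try apply H1.
      intros n Hn. rewrite (H2 n), (H2 (S (snd x))) by lia. reflexivity.
    - intros y Hy. pose proof (Hext x y Hy). pose proof (Hval y (proj1 Hy)). lra.
    - exists (exist _ y (proj1 Hy)). split; assumption. }
  assert (Hst0 : st (s0, Nat.max k k0)).
  { repeat split; simpl; try assumption; try lia; try apply agree_refl.
    intros n Hn. rewrite (Hk n), (Hk (Nat.max k k0)) by lia. reflexivity. }
  set (next := fun x => proj1_sig (constructive_indefinite_description _ (Hgreedy x))).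
  set (path := fun i => proj1_sig (Nat.iter i next (exist st _ Hst0))).
  assert (Hpath : forall i, st (path i)) by (intros i; apply proj2_sig).
  assert (Hnext : forall i, ext (path i) (path (S i)) /\
    forall z, ext (path i) z -> val z - val (path i) <= 2 * (val (path (S i)) - val (path i))).
  { intros i.
    exact (proj2_sig (constructive_indefinite_description _
      (Hgreedy (Nat.iter i next (exist st _ Hst0))))). }
  assert (Hlen : forall i, (i <= snd (path i))%nat).
  { induction i as [|i IH]; [lia|]. destruct (Hnext i) as [[_ [H _]] _]. lia. }
  assert (Hagree : forall i j, (i <= j)%nat ->
    (snd (path i) <= snd (path j))%nat /\ agree (S (snd (path i))) (fst (path i)) (fst (path j))).
  { intros i j H. induction H as [|j H [IH1 IH2]]; [split; [lia | apply agree_refl]|].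
    destruct (Hnext j) as [[_ [H1 H2]] _]. split; [lia|].
    eapply agree_trans; [exact IH2|]. eapply agree_weaken; [|exact H2]. lia. }
  (* the term n is read off at the stage n, which already fixes it *)
  set (lim := fun n => fst (path n) n).
  assert (Hlim : forall i n, (n <= snd (path i))%nat -> lim n = fst (path i) n).
  { intros i n Hn. unfold lim. destruct (le_lt_dec n i) as [L | L].
    - symmetry. apply Hagree; [assumption|]. pose proof (Hlen n). lia.
    - apply Hagree; lia. }
  assert (Hmono : forall m n, (m <= n)%nat -> lim m <= lim n).
  { intros m n H. rewrite (Hlim n m) by (pose proof (Hlen n); lia). apply term_le, H. }
  assert (Hbound : forall n, lim n <= b).
  { intros n. apply Qle_trans with (val (path n)); [|apply Hval, Hpath].
    apply settled_le, Hpath. }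
  set (s := {| term_of := lim; term_le := Hmono; term_bounded := ex_intro _ b Hbound |}).
  assert (Hs : ball k0 b0 s0 s).
  { split; [|exists b; split; assumption]. intros i Hi. simpl.
    destruct (Hpath 0%nat) as [[H _] [_ [_ Hk0]]]. rewrite (Hlim 0%nat i) by lia. apply H, Hi. }
  assert (Hle : forall i n, fst (path i) n <= lim (snd (path i))).
  { intros i n. rewrite (Hlim i) by lia. apply settled_le, Hpath. }
  destruct (Hclopen s Hs) as [[l [d [[c [Hc Hsc]] HPs]]] | [l [d [[c [Hc Hsc]] HPs]]]].
  - (* at every late stage a jump to some w above the limit was available, so that each
       greedy step gained at least half of the constant w - m *)
    simpl in Hsc.
    assert (Hw : exists m w, m < w /\ w < d /\ w < b0 /\ forall n, lim n <= m).
    { set (m := if Qlt_le_dec c b then c else b).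
      set (e := if Qlt_le_dec d b0 then d else b0).
      assert (Hme : m < e) by (unfold m, e; destruct (Qlt_le_dec c b), (Qlt_le_dec d b0); lra).
      assert (He : e <= d /\ e <= b0) by (unfold e; destruct (Qlt_le_dec d b0); lra).
      exists m, ((m + e) * (1 # 2)). split; [lra|]. split; [lra|]. split; [lra|].
      intros n. unfold m. destruct (Qlt_le_dec c b); auto. }
    destruct Hw as [m [w [Hmw [Hwd [Hwb Hm]]]]].
    apply (bounded_no_gain (fun i => val (path (l + i)%nat)) ((w - m) * (1 # 2)) b).
    + lra.
    + intros i. rewrite Nat.add_succ_r. set (j := (l + i)%nat).
      assert (Hj : fst (path j) (snd (path j)) <= m).
      { apply Qle_trans with (lim (snd (path j))); auto. }
      destruct (jump (fst (path j)) (snd (path j)) w) as [z [Hz1 [Hz2 Hz3]]]; [lra|].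
      destruct (Hpath j) as [[Hj0 _] [_ [_ Hjk]]].
      assert (Hzw : forall n, z n <= w) by (intros n; rewrite <- Hz3; apply settled_le, Hz2).
      assert (E : ext (path j) (z, S (snd (path j)))).
      { split; [|split; [simpl; lia | exact Hz1]]. repeat split; simpl.
        - eapply agree_trans; [exact Hj0|]. eapply agree_weaken; [|exact Hz1]. lia.
        - exists w. auto.
        - exact Hz2.
        - apply HPs. split.
          + intros n Hn. pose proof (Hlen j). rewrite Hz1 by lia. simpl. symmetry.
            apply Hlim. lia.
          + exists w. auto.
        - lia. }
      apply (proj2 (Hnext j)) in E. unfold val in E at 1. simpl in E. rewrite Hz3 in E.
      unfold val in E at 1. unfold val at 1. unfold val in E. unfold val. lra.
    + intros i. apply Hval, Hpath.
  - apply (HPs (fst (path l))).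
    + split.
      * intros n Hn. symmetry. apply (Hlim l). pose proof (Hlen l). lia.
      * exists c. split; [exact Hc|]. intros n. eapply Qle_trans; [apply Hle | apply Hsc].
    + apply Hpath.
Qed.

#[local] Existing Instance monotone_space.

Definition zero_sequence : monotone :=
  {| term_of := fun _ => 0; term_le := fun _ _ _ => Qle_refl 0;
     term_bounded := ex_intro _ 0 (fun _ => Qle_refl 0) |}.

(** Near the constant sequence 0, take a tenth of the bound as the precision: the value
    that approximates the limit at 0 would persist up to limits above four times the
    precision. *)
Lemma incomplete : ~ Sem.cauchy_completeness zero_sequence.
Proof.
  intros HC.
  destruct (completeness_approximates genericV zero_sequence genericV_Cauchy HC)
    as [H [k0 [b0 [Hb0 HH]]]].
  assert (Hpos : 0 < b0).
  { destruct Hb0 as [c [Hc H0]]. specialize (H0 0%nat). simpl in H0. lra. }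
  set (e := b0 * (1 # 10)). assert (He : 0 < e) by (unfold e; lra).
  assert (Happrox : forall s k q, ball k0 b0 zero_sequence s -> settled k s -> H e q s ->
    Qabs (s k - q) < 2 * e).
  { intros s k q Hs Hk Hq. destruct (HH s Hs e He) as [_ [_ Hlim]].
    destruct (Hlim q Hq) as [K HK]. specialize (HK (S (k + K)) (s (S (k + K)))).
    rewrite (Hk (S (k + K))) in HK by lia. apply HK; [lia|].
    apply genericV_value. rewrite (Hk (S (k + K))) by lia. reflexivity. }
  assert (Hzero : ball k0 b0 zero_sequence zero_sequence) by (split; [apply agree_refl | exact Hb0]).
  assert (Hsettled : settled 0 zero_sequence) by (intros n _; reflexivity).
  destruct (HH _ Hzero e He) as [[q0 Hq0] _].
  destruct (climb (fun s => exists q, q == q0 /\ H e q s) k0 b0 zero_sequence 0)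
    with (b := 4 * e) as [s [l [Hs [Hl [[q [Eq Hq]] Hgt]]]]].
  - intros s Hs. destruct (classic (exists q, q == q0 /\ H e q s)) as [[q [Eq Hq]] | Hn].
    + left. apply (holds_near (H e q)) in Hq. revert Hq. apply near_mono. eauto.
    + right. destruct (HH s Hs e He) as [[q Hq] _].
      assert (Hs' : near (ball k0 b0 zero_sequence) s).
      { exists k0, b0. split; [apply Hs|]. intros s' [H1 H2]. split; [|exact H2].
        eapply agree_trans; [apply Hs | exact H1]. }
      apply (holds_near (H e q)) in Hq as Hq'.
      generalize (near_and _ _ _ Hs' Hq'). apply near_mono. intros s' [Hb' H'] [q' [E' Hq'']].
      apply Hn. exists q. split; [|exact Hq]. rewrite <- E'.
      apply (HH s' Hb' e He); assumption.
  - exact Hb0.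
  - exact Hsettled.
  - exists q0. split; [reflexivity | exact Hq0].
  - unfold e. lra.
  - apply (Happrox s l q Hs Hl) in Hq. apply (Happrox zero_sequence 0%nat q0 Hzero Hsettled) in Hq0.
    rewrite Eq in Hq. change (Qabs (0 - q0) < 2 * e) in Hq0. apply Qabs_Qlt_condition in Hq, Hq0. lra.
Qed.

Theorem theorem5p1 :
  consistent classical ZF ->
  ~ proves intuitionistic IZF_Ref cauchy_completeness.
Proof.
  intros _ D. apply incomplete. rewrite <- (tr_cauchy_completeness (fun _ => emptyV)).
  eapply soundness; [|exact D|].
  - intros a Ha r t. apply IZF_Ref_valid, Ha.
  - intros a [].
Qed.
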